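(* Let $P_{\bullet}$ and $Q_{\bullet}$ be two acyclic bounded complexes of vector bundles on $\mathbb{P}^n$, nonzero only in degrees between $-n-1$ and $0$, and let $\varphi_{\bullet}: P_{\bullet}\longrightarrow Q_{\bullet}(-j)[j]$ be a morphism of complexes. Write $p_t=\operatorname{rk}(P_t)$ and $q_t=\operatorname{rk}(Q_t)$. Assume: (i) $P_{\bullet}$ is $(r_P,s_P)$-linear and $Q_{\bullet}$ is $(r_Q,s_Q)$-linear. (ii) There exists an integer $i$, $r_P\le i<s_P$, such that $r_Q\le i+j<s_Q$ and the morphisms $$\varphi_i:P_i\longrightarrow Q_{i+j}(-j)\quad\text{and}\quad \varphi_{i+1}:P_{i+1}\longrightarrow Q_{i+j+1}(-j)$$ are surjective. Then there exists a $b_{i+2}\times(p_{i+1}-q_{i+j+1})$ matrix $M$, with $b_{i+2}:=\dim\ker\varphi_{i+2}$, with linear entries and constant rank $$\sum_{k=0}^{-i-2}(-1)^k p_{i+2+k}-\sum_{k=0}^{-i-j-2}(-1)^k q_{i+j+2+k}.$$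
   Context: We work over an algebraically closed field $k$ of characteristic $0$; $\mathbb{P}^n=\mathbb{P}(V)$ is the set of lines in a $k$-vector space $V$ with $\dim V=n+1$, and $H^0(\mathbb{P}^n,\mathcal{O}_{\mathbb{P}^n}(1))=V^*$. A matrix with linear entries is a matrix whose entries are linear forms in $n+1$ variables; it has constant rank $r$ if its evaluation at every nonzero vector of $V$ has rank $r$. A bounded complex $P_\bullet$ of coherent sheaves on $\mathbb{P}^n$ is a sequence $\cdots\to P_{t-1}\xrightarrow{d_P^{t-1}}P_t\xrightarrow{d_P^t}P_{t+1}\to\cdots$ of coherent sheaves with $d_P^t d_P^{t-1}=0$ for every $t$ and $P_t=0$ for $t\gg0$ and $t\ll0$. It is acyclic if it is exact everywhere, i.e. $\ker(d_P^t)=\operatorname{Im}(d_P^{t-1})$ for all $t$. It is $(r,s)$-linear if $P_t=\mathcal{O}_{\mathbb{P}^n}(t)^{p_t}$ for all $r\le t\le s$, which implies that the differentials $d_P^t$ with $r\le t<s$ can be represented by matrices with linear entries. $P[j]_\bullet$ denotes the complex obtained by shifting the degree $j$ places to the left, $P[j]_t=P_{j+t}$, and $P_t(j)=P_t\otimes\mathcal{O}_{\mathbb{P}^n}(j)$; thus $\varphi_\bullet$ has components $\varphi_t:P_t\to Q_{t+j}(-j)$.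
   Formalization: ''b_{i+2} = dim ker φ_{i+2}'' is taken to mean ker φ_{i+2} ≅ O(i+2)^{b_{i+2}}, automatic if i+2 ≤ s_P and i+j+2 ≤ s_Q; otherwise this is an added assumption, without which the claim fails (Q=0, P: O(-2)→O(-1)^{n+1}→T(-2), n≥2). *)

(* Defs.v *)
From HB Require Import structures.
From mathcomp Require Import all_boot all_order all_algebra.
From mathcomp Require Import mpoly.
From mathcomp Require Import boolp classical_sets functions.

Set Implicit Arguments.
Unset Strict Implicit.
Unset Printing Implicit Defensive.

Import Order.TTheory GRing.Theory Num.Theory.
Local Open Scope classical_set_scope.
Local Open Scope ring_scope.

(** Sheaves of O-modules on the projective space P^n = P(V), V = k^(n+1), over
    an algebraically closed field k, in the classical language of varieties:
    a point of P^n is a line of V, represented by any of its nonzero vectors. *)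

Definition basic_open (k : closedFieldType) (n : nat) (G : {mpoly k[n.+1]}) :
  set 'rV[k]_n.+1 := [set v : 'rV[k]_n.+1 | v != 0 /\ G.@[v ord0] != 0].

(** An open subset of P^n is given by its cone with the origin removed.  Being a
    union of sets [basic_open G] with G homogeneous, that cone is automatically
    stable under nonzero scalars. *)
Record zopen (k : closedFieldType) (n : nat) := Zopen {
  zset :> set 'rV[k]_n.+1;
  zsetP : forall v, zset v -> exists (e : nat) (G : {mpoly k[n.+1]}),
    [/\ G \is e.-homog, basic_open G v & basic_open G `<=` zset] }.

Section Regular.
Variables (k : closedFieldType) (n : nat).
Implicit Types U W T : zopen k n.

(** [regular e f]: locally on U, the function f is a quotient F / G of
    homogeneous polynomials with deg F - deg G = e.  Such functions on the cone
    over U are the sections of O(e) over U; for e = 0 they are the regular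
    functions on U, and for e = 1 and U = P^n the linear forms, i.e. V^*. *)
Definition regular (e : int) U (f : zset U -> k) : Prop :=
  forall v : zset U, exists (c d : nat) (F G : {mpoly k[n.+1]}),
    [/\ F \is c.-homog, G \is d.-homog, c%:Z = d%:Z + e,
        G.@[val v ord0] != 0
      & forall w : zset U, G.@[val w ord0] != 0 ->
          f w = F.@[val w ord0] / G.@[val w ord0]].

Definition regularb (e : int) U : pred (zset U -> k) :=
  fun f => `[< @regular e U f >].

Lemma regular0 e U : @regular e U 0.
Proof.
move=> v; case: (intP e) => [|m|m].
- exists 0%N, 0%N, 0, 1; split; rewrite ?rpred0 ?dhomog1 ?meval1 ?oner_eq0 //.
  by move=> w _; rewrite meval0 mul0r.
- exists m.+1, 0%N, 0, 1; split; rewrite ?rpred0 ?dhomog1 ?meval1 ?oner_eq0 //.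
  by move=> w _; rewrite meval0 mul0r.
- have [i vi] : exists i, val v ord0 i != 0.
    have [d [G [_ [vN0 _] _]]] := zsetP (set_mem (valP v)).
    exact/rV0Pn.
  exists 0%N, m.+1, 0, ('X_i ^+ m.+1); split; rewrite ?rpred0 //.
  + by have := dhomogMn m.+1 (_ : 'X_i \is 1.-homog); rewrite mul1n; apply; rewrite dhomogX /= mdeg1.
  + by rewrite subrr.
  + by rewrite rmorphXn /= mevalXU expf_neq0.
  + by move=> w _; rewrite meval0 mul0r.
Qed.

Lemma regularD e U (f g : zset U -> k) :
  regular e f -> regular e g -> regular e (f + g).
Proof.
move=> hf hg v; have [a [b [F [G [hF hG hd Gv hfG]]]]] := hf v.
have [a' [b' [F' [G' [hF' hG' hd' Gv' hfG']]]]] := hg v.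
exists (a + b')%N, (b + b')%N, (F * G' + F' * G), (G * G'); split.
- have E : (a + b' = a' + b)%N.
    by apply/eqP; rewrite -eqz_nat !PoszD hd hd' addrAC [X in _ == X]addrC addrA.
  by apply: rpredD; [|rewrite E]; apply: dhomogM.
- exact: dhomogM.
- by rewrite !PoszD hd addrAC.
- by rewrite mevalM mulf_neq0.
- move=> w; rewrite mevalM mulf_eq0 negb_or => /andP[Gw Gw'].
  rewrite (_ : (f + g) w = f w + g w) // hfG // hfG' // mevalD !mevalM.
  by rewrite addf_div.
Qed.

Lemma regularN e U (f : zset U -> k) : regular e f -> regular e (- f).
Proof.
move=> hf v; have [a [b [F [G [hF hG hd Gv hfG]]]]] := hf v.
exists a, b, (- F), G; split; rewrite ?rpredN // => w Gw.
by rewrite (_ : (- f) w = - f w) // hfG // mevalN mulNr.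
Qed.

Lemma regularM e e' U (f g : zset U -> k) :
  regular e f -> regular e' g -> regular (e + e') (f * g).
Proof.
move=> hf hg v; have [a [b [F [G [hF hG hd Gv hfG]]]]] := hf v.
have [a' [b' [F' [G' [hF' hG' hd' Gv' hfG']]]]] := hg v.
exists (a + a')%N, (b + b')%N, (F * F'), (G * G'); split.
- exact: dhomogM.
- exact: dhomogM.
- by rewrite !PoszD hd hd' addrACA.
- by rewrite mevalM mulf_neq0.
- move=> w; rewrite mevalM mulf_eq0 negb_or => /andP[Gw Gw'].
  by rewrite (_ : (f * g) w = f w * g w) // hfG // hfG' // !mevalM mulf_div.
Qed.

Lemma regular1 U : @regular 0 U 1.
Proof.
move=> v; exists 0%N, 0%N, 1, 1.
split; rewrite ?dhomog1 ?meval1 ?oner_eq0 // => w _.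
by rewrite meval1 divr1.
Qed.

Lemma regularb_zmod e U : zmod_closed (@regularb e U).
Proof.
split=> [|f g /asboolP hf /asboolP hg]; apply/asboolP; first exact: regular0.
exact/regularD/regularN.
Qed.

Lemma regularb_mul U : mulr_closed (@regularb 0 U).
Proof.
split=> [|f g /asboolP hf /asboolP hg]; apply/asboolP; first exact: regular1.
by rewrite -[0]addr0; exact: regularM.
Qed.

HB.instance Definition _ e U :=
  GRing.isZmodClosed.Build (zset U -> k) (@regularb e U) (regularb_zmod e U).
HB.instance Definition _ U :=
  GRing.isMulClosed.Build (zset U -> k) (@regularb 0 U) (regularb_mul U).

(** Sections of O(e) over U, and the ring O(U). *)
Definition osec (e : int) U := {f : zset U -> k | regularb e f}.
Definition oring U := osec 0 U.

HB.instance Definition _ e U := SubType.on (osec e U).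
HB.instance Definition _ e U := [Choice of osec e U by <:].
HB.instance Definition _ e U := [SubChoice_isSubZmodule of osec e U by <:].
HB.instance Definition _ U := SubType.on (oring U).
HB.instance Definition _ U := [Choice of oring U by <:].
HB.instance Definition _ U :=
  GRing.SubChoice_isSubComPzRing.Build _ _ (oring U) (subringClosedP _).

Lemma oscale_subproof e U (a : oring U) (s : osec e U) :
  regularb e (val a * val s).
Proof.
apply/asboolP; have := regularM (asboolW (valP a)) (asboolW (valP s)).
by rewrite add0r.
Qed.

Definition oscale e U (a : oring U) (s : osec e U) : osec e U :=
  Sub (val a * val s) (oscale_subproof a s).

Lemma oscaleA e U (a b : oring U) (s : osec e U) :
  oscale a (oscale b s) = oscale (a * b) s.
Proof. by apply: val_inj; rewrite /= mulrA. Qed.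

Lemma oscale1 e U : left_id 1 (@oscale e U).
Proof. by move=> s; apply: val_inj; rewrite /= mul1r. Qed.

Lemma oscaleDr e U : right_distributive (@oscale e U) +%R.
Proof. by move=> a s t; apply: val_inj; rewrite /= mulrDr. Qed.

Lemma oscaleDl e U (s : osec e U) : {morph (@oscale e U)^~ s : a b / a + b}.
Proof. by move=> a b; apply: val_inj; rewrite /= mulrDl. Qed.

HB.instance Definition _ e U := GRing.Zmodule_isLmodule.Build (oring U)
  (osec e U) (@oscaleA e U) (@oscale1 e U) (@oscaleDr e U) (@oscaleDl e U).

Definition zincl U W (h : W `<=` U) (w : zset W) : zset U :=
  SigSub (mem_set (h _ (set_mem (valP w)))).

Lemma ores_subproof e U W (h : W `<=` U) (s : osec e U) :
  regularb e (val s \o zincl h).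
Proof.
apply/asboolP => v; have /asboolP/(_ (zincl h v)) := valP s.
move=> [c [d [F [G [hF hG hd Gv hs]]]]]; exists c, d, F, G; split=> // w Gw.
exact: (hs (zincl h w)).
Qed.

Definition ores e U W (h : W `<=` U) (s : osec e U) : osec e W :=
  Sub (val s \o zincl h) (ores_subproof h s).

Lemma oresD e U W (h : W `<=` U) : {morph (@ores e U W h) : s t / s + t}.
Proof. by move=> s t; apply: val_inj. Qed.

Lemma oresZ e U W (h : W `<=` U) (a : oring U) (s : osec e U) :
  ores h (a *: s) = (ores h a : oring W) *: ores h s.
Proof. exact: val_inj. Qed.

Lemma zincl_id U (h : U `<=` U) v : zincl h v = v.
Proof. exact: val_inj. Qed.

Lemma ores_id e U (h : U `<=` U) (s : osec e U) : ores h s = s.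
Proof. by apply: val_inj; apply: funext => v /=; rewrite zincl_id. Qed.

Lemma ores_comp e U W T (h : W `<=` U) (h' : T `<=` W) (h'' : T `<=` U)
  (s : osec e U) : ores h' (ores h s) = ores h'' s.
Proof.
by apply: val_inj; apply: funext => v /=; congr (val s _); apply: val_inj.
Qed.

End Regular.

Section Opens.
Variables (k : closedFieldType) (n : nat).
Implicit Types U W T : zopen k n.

Lemma zcap_subproof U W (v : 'rV[k]_n.+1) : (zset U `&` zset W) v ->
  exists (e : nat) (G : {mpoly k[n.+1]}),
    [/\ G \is e.-homog, basic_open G v & basic_open G `<=` zset U `&` zset W].
Proof.
move=> [/zsetP[e [G [hG [v0 Gv] GU]]] /zsetP[e' [G' [hG' [_ Gv'] GW]]]].
exists (e + e')%N, (G * G'); split; first exact: dhomogM.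
  by split=> //; rewrite mevalM mulf_neq0.
move=> w [w0]; rewrite mevalM mulf_eq0 negb_or => /andP[Gw Gw'].
by split; [apply: GU|apply: GW].
Qed.

Definition zcap U W : zopen k n := Zopen (@zcap_subproof U W).

Lemma zcap_sub U W T : T `<=` U -> T `<=` W -> T `<=` zcap U W.
Proof. by move=> hU hW v Tv; split; [apply: hU|apply: hW]. Qed.

Lemma zcapl U W : zcap U W `<=` U. Proof. by move=> v []. Qed.

Lemma zcapr U W : zcap U W `<=` W. Proof. by move=> v []. Qed.

Lemma zchart_subproof (a : 'I_n.+1) (v : 'rV[k]_n.+1) :
  basic_open 'X_a v -> exists (e : nat) (G : {mpoly k[n.+1]}),
    [/\ G \is e.-homog, basic_open G v & basic_open G `<=` basic_open 'X_a].
Proof. by move=> hv; exists 1%N, 'X_a; split; rewrite // dhomogX /= mdeg1. Qed.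

Definition zchart (a : 'I_n.+1) : zopen k n := Zopen (@zchart_subproof a).

Lemma zchart_cover U (v : 'rV[k]_n.+1) :
  zset U v ->
  exists a, zset (zcap U (zchart a)) v.
Proof.
move=> Uv; have [e [G [_ [v0 _] _]]] := zsetP Uv.
by have /rV0Pn[a va] := v0; exists a; split=> //; split; rewrite ?mevalXU.
Qed.

Lemma ratio_subproof (a b : 'I_n.+1) (d : int) W :
  W `<=` zchart a -> W `<=` zchart b ->
  regularb 0 (fun w : zset W => (val w ord0 b / val w ord0 a) ^ d).
Proof.
move=> ha hb; apply/asboolP => v.
have X1 (i : 'I_n.+1) : ('X_i : {mpoly k[n.+1]}) \is 1.-homog.
  by rewrite dhomogX /= mdeg1.
have Xm (i : 'I_n.+1) m : ('X_i ^+ m : {mpoly k[n.+1]}) \is m.-homog.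
  by have := dhomogMn m (X1 i); rewrite mul1n.
have nz (w : zset W) : val w ord0 a != 0 /\ val w ord0 b != 0.
  have [_] := ha _ (set_mem (valP w)); have [_] := hb _ (set_mem (valP w)).
  by rewrite !mevalXU.
have [va vb] := nz v; case: d => m.
  exists m, m, ('X_b ^+ m), ('X_a ^+ m).
  split; rewrite ?addr0 // ?rmorphXn /= ?mevalXU ?expf_neq0 // => w _.
  by rewrite !rmorphXn /= !mevalXU -exprnP expr_div_n.
exists m.+1, m.+1, ('X_a ^+ m.+1), ('X_b ^+ m.+1).
split; rewrite ?addr0 // ?rmorphXn /= ?mevalXU ?expf_neq0 // => w _.
by rewrite !rmorphXn /= !mevalXU NegzE -exprnN expr_div_n invf_div.
Qed.

Definition ratio (a b : 'I_n.+1) (d : int) W (ha : W `<=` zchart a)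
  (hb : W `<=` zchart b) : oring W := Sub _ (ratio_subproof d ha hb).

End Opens.

Definition zcover (k : closedFieldType) (n : nat) (U : zopen k n) (I : Type)
  (W : I -> zopen k n) : Prop := forall v, zset U v -> exists i, zset (W i) v.

Record omod (k : closedFieldType) (n : nat) := OMod {
  sec :> forall U : zopen k n, lmodType (oring U);
  res : forall U W : zopen k n, W `<=` U -> sec U -> sec W;
  resD : forall (U W : zopen k n) (h : W `<=` U), {morph res h : s t / s + t};
  resZ : forall (U W : zopen k n) (h : W `<=` U) (a : oring U) (s : sec U),
    res h (a *: s) = (ores h a : oring W) *: res h s;
  res_id : forall (U : zopen k n) (h : U `<=` U) (s : sec U), res h s = s;
  res_comp : forall (U W T : zopen k n) (h : W `<=` U) (h' : T `<=` W)
    (h'' : T `<=` U) (s : sec U), res h' (res h s) = res h'' s;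
  res_glue : forall (U : zopen k n) (I : Type) (W : I -> zopen k n)
    (h : forall i, W i `<=` U) (s : forall i, sec (W i)), zcover U W ->
    (forall i j (T : zopen k n) (hi : T `<=` W i) (hj : T `<=` W j),
       res hi (s i) = res hj (s j)) ->
    exists! t : sec U, forall i, res (h i) t = s i }.

Record omor (k : closedFieldType) (n : nat) (F G : omod k n) := OMor {
  omor_fun :> forall U : zopen k n, {linear F U -> G U};
  omor_nat : forall (U W : zopen k n) (h : W `<=` U) (s : F U),
    omor_fun W (res h s) = res h (omor_fun U s) }.

Definition oiso (k : closedFieldType) (n : nat) (F G : omod k n) : Prop :=
  exists f : omor F G, forall U, bijective (f U).

(** Membership in the image sheaf: being locally the image of a section. *)
Definition in_image (k : closedFieldType) (n : nat) (F G : omod k n)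
  (f : omor F G) (U : zopen k n) (s : G U) : Prop :=
  forall v, zset U v -> exists (W : zopen k n) (h : W `<=` U) (t : F W),
    zset W v /\ f W t = res h s.

Definition osurj (k : closedFieldType) (n : nat) (F G : omod k n)
  (f : omor F G) : Prop := forall (U : zopen k n) (s : G U), in_image f s.

Definition oexact (k : closedFieldType) (n : nat) (F G H : omod k n)
  (f : omor F G) (g : omor G H) : Prop :=
  forall (U : zopen k n) (s : G U), g U s = 0 <-> in_image f s.

Definition is_okernel (k : closedFieldType) (n : nat) (F G H : omod k n)
  (iota : omor F G) (g : omor G H) : Prop :=
  forall U : zopen k n, injective (iota U) /\
    forall s : G U, g U s = 0 <-> exists t, iota U t = s.

Definition ozero (k : closedFieldType) (n : nat) (F : omod k n) : Prop :=
  forall (U : zopen k n) (s : F U), s = 0.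

(** Vector bundles of rank r: locally there is a frame, i.e. r sections inducing
    an isomorphism of O^r with F. *)
Definition vbundle (k : closedFieldType) (n : nat) (F : omod k n) (r : nat) :
  Prop :=
  forall v : 'rV[k]_n.+1, v != 0 -> exists (U : zopen k n) (e : 'I_r -> F U),
    zset U v /\ forall (W : zopen k n) (h : W `<=` U) (s : F W),
      exists! a : {ffun 'I_r -> oring W}, s = \sum_i a i *: res h (e i).

Section Sums.
Variables (k : closedFieldType) (n : nat).
Implicit Types U W T : zopen k n.

Lemma ores_glue (e : int) U (I : Type) (W : I -> zopen k n)
    (h : forall i, W i `<=` U) (s : forall i, osec e (W i)) :
  zcover U W ->
  (forall i j T (hi : T `<=` W i) (hj : T `<=` W j),
     ores hi (s i) = ores hj (s j)) ->
  exists! t : osec e U, forall i, ores (h i) t = s i.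
Proof.
move=> cov hs.
pose idx (v : zset U) := projT1 (cid (cov _ (set_mem (valP v)))).
have idxP v : zset (W (idx v)) (val v) by rewrite /idx; case: cid.
pose f (v : zset U) : k := val (s (idx v)) (SigSub (mem_set (idxP v))).
have fE i (w : zset (W i)) : f (zincl (h i) w) = val (s i) w.
  set v := zincl (h i) w; have wT : zset (zcap (W (idx v)) (W i)) (val w).
    by split; [exact: (idxP v)|exact: set_mem (valP w)].
  have := hs (idx v) i _ (@zcapl _ _ _ _) (@zcapr _ _ _ _).
  move/(congr1 val)/(congr1 (fun g => g (SigSub (mem_set wT)))) => /= hvw.
  by rewrite /f; apply: etrans (etrans _ hvw) _; congr (sval (s _) _); apply: val_inj.
have freg : regularb e f.
  apply/asboolP => v; have [i Wv] := cov _ (set_mem (valP v)).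
  have [b [H [hH [v0 Hv] HW]]] := zsetP Wv.
  have /asboolP/(_ (SigSub (mem_set Wv))) := valP (s i).
  move=> [c [d [F [G [hF hG hd Gv hsi]]]]].
  exists (c + b)%N, (d + b)%N, (F * H), (G * H); split; try exact: dhomogM.
  - by rewrite !PoszD hd addrAC.
  - by rewrite mevalM mulf_neq0.
  move=> w; rewrite mevalM mulf_eq0 negb_or => /andP[Gw Hw].
  have Ww : zset (W i) (val w).
    by apply: HW; split=> //; have [? [? [_ []]]] := zsetP (set_mem (valP w)).
  rewrite (_ : w = zincl (h i) (SigSub (mem_set Ww))); last exact: val_inj.
  by rewrite fE hsi //= !mevalM -mulf_div divff // mulr1.
exists (Sub f freg); split=> [i|t ht].
  by apply: val_inj; apply: funext => w /=; rewrite fE.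
apply: val_inj; apply: funext => v /=; have [i Wv] := cov _ (set_mem (valP v)).
rewrite (_ : v = zincl (h i) (SigSub (mem_set Wv))); last exact: val_inj.
by rewrite fE -ht.
Qed.

Definition ostruct (e : int) : omod k n :=
  OMod (@oresD k n e) (@oresZ k n e) (@ores_id k n e) (@ores_comp k n e)
       (@ores_glue e).

Variables (p : nat) (F : omod k n).

Definition osum_sec U := {ffun 'I_p -> F U}.

HB.instance Definition _ U := GRing.Zmodule.on (osum_sec U).

Definition osum_scale U (a : oring U) (s : osum_sec U) : osum_sec U :=
  [ffun i => a *: s i].

Lemma osum_scaleA U (a b : oring U) (s : osum_sec U) :
  osum_scale a (osum_scale b s) = osum_scale (a * b) s.
Proof. by apply/ffunP => i; rewrite !ffunE scalerA. Qed.

Lemma osum_scale1 U : left_id 1 (@osum_scale U).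
Proof. by move=> s; apply/ffunP => i; rewrite !ffunE scale1r. Qed.

Lemma osum_scaleDr U : right_distributive (@osum_scale U) +%R.
Proof. by move=> a s t; apply/ffunP => i; rewrite !ffunE scalerDr. Qed.

Lemma osum_scaleDl U (s : osum_sec U) :
  {morph (@osum_scale U)^~ s : a b / a + b}.
Proof. by move=> a b; apply/ffunP => i; rewrite !ffunE scalerDl. Qed.

HB.instance Definition _ U := GRing.Zmodule_isLmodule.Build (oring U)
  (osum_sec U) (@osum_scaleA U) (@osum_scale1 U) (@osum_scaleDr U)
  (@osum_scaleDl U).

Definition osum_res U W (h : W `<=` U) (s : osum_sec U) : osum_sec W :=
  [ffun i => res h (s i)].

Lemma osum_resD U W (h : W `<=` U) : {morph osum_res h : s t / s + t}.
Proof. by move=> s t; apply/ffunP => i; rewrite !ffunE resD. Qed.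

Lemma osum_resZ U W (h : W `<=` U) (a : oring U) (s : osum_sec U) :
  osum_res h (a *: s) = (ores h a : oring W) *: osum_res h s.
Proof. by apply/ffunP => i; rewrite !ffunE resZ. Qed.

Lemma osum_res_id U (h : U `<=` U) (s : osum_sec U) : osum_res h s = s.
Proof. by apply/ffunP => i; rewrite !ffunE res_id. Qed.

Lemma osum_res_comp U W T (h : W `<=` U) (h' : T `<=` W) (h'' : T `<=` U)
  (s : osum_sec U) : osum_res h' (osum_res h s) = osum_res h'' s.
Proof. by apply/ffunP => i; rewrite !ffunE (res_comp _ _ h''). Qed.

Lemma osum_res_glue U (I : Type) (W : I -> zopen k n)
    (h : forall i, W i `<=` U) (s : forall i, osum_sec (W i)) :
  zcover U W ->
  (forall i j T (hi : T `<=` W i) (hj : T `<=` W j),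
     osum_res hi (s i) = osum_res hj (s j)) ->
  exists! t : osum_sec U, forall i, osum_res (h i) t = s i.
Proof.
move=> cov hs.
have ex j : exists! t : F U, forall i, res (h i) t = s i j.
  apply: res_glue => // i i' T hi hi'.
  by have /ffunP/(_ j) := hs i i' T hi hi'; rewrite !ffunE.
pose t j := projT1 (cid (ex j)).
have tP j : unique (fun t : F U => forall i, res (h i) t = s i j) (t j).
  by rewrite /t; case: cid.
exists [ffun j => t j]; split=> [i|t' ht'].
  by apply/ffunP => j; rewrite !ffunE; case: (tP j).
apply/ffunP => j; rewrite ffunE; case: (tP j) => _; apply=> i.
by rewrite -ht' ffunE.
Qed.

Definition osum : omod k n :=
  OMod osum_resD osum_resZ osum_res_id osum_res_comp osum_res_glue.

End Sums.

Section Twist.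
Variables (k : closedFieldType) (n : nat).
Implicit Types (U V W T : zopen k n) (F : omod k n).

Lemma res_sep F U (I : Type) (W : I -> zopen k n) (h : forall i, W i `<=` U)
    (s t : F U) : zcover U W -> (forall i, res (h i) s = res (h i) t) -> s = t.
Proof.
move=> cov hst; have [|r [_ hr]] := @res_glue _ _ F U I W h (fun i => res (h i) t) cov.
  by move=> i j T hi hj; rewrite !(res_comp _ _ (subset_trans hi (h i))).
by rewrite -(hr s) // -(hr t).
Qed.

(** F(d) = F (x) O(d), glued from the restrictions of F to the standard charts:
    a family (s_a) with s_a = (x_b / x_a)^d s_b stands for the section which is
    s_a (x) x_a^d on the chart x_a <> 0. *)
Record twist_sec (F : omod k n) (d : int) (U : zopen k n) := TwistSec {
  tsec :> forall a : 'I_n.+1, F (zcap U (zchart k a));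
  tsecP : forall (a b : 'I_n.+1) (W : zopen k n) (h : W `<=` U)
    (ha : W `<=` zchart k a) (hb : W `<=` zchart k b),
    res (zcap_sub h ha) (tsec a) =
      ratio d ha hb *: res (zcap_sub h hb) (tsec b) }.

Lemma tsec_eq F d U (s t : twist_sec F d U) : (forall a, s a = t a) -> s = t.
Proof.
case: s t => [s sP] [t tP] /= st.
have E : s = t by apply: functional_extensionality_dep.
by case: t / E tP {st} => tP; congr TwistSec; apply: Prop_irrelevance.
Qed.

HB.instance Definition _ F d U := gen_eqMixin (twist_sec F d U).
HB.instance Definition _ F d U := gen_choiceMixin (twist_sec F d U).

Section Ops.
Variables (F : omod k n) (d : int).

Lemma res0 U W (h : W `<=` U) : res h (0 : F U) = 0.
Proof. by apply: (addIr (res h 0)); rewrite -resD !add0r. Qed.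

Lemma resN U W (h : W `<=` U) : {morph @res k n F U W h : s / - s}.
Proof. by move=> s; apply: (addIr (res h s)); rewrite -resD !addNr res0. Qed.

Lemma tzero_subproof U (a b : 'I_n.+1) W (h : W `<=` U)
    (ha : W `<=` zchart k a) (hb : W `<=` zchart k b) :
  res (zcap_sub h ha) (0 : F _) = ratio d ha hb *: res (zcap_sub h hb) (0 : F _).
Proof. by rewrite !res0 scaler0. Qed.

Definition tzero U : twist_sec F d U := TwistSec (@tzero_subproof U).

Lemma tadd_subproof U (s t : twist_sec F d U) (a b : 'I_n.+1) W (h : W `<=` U)
    (ha : W `<=` zchart k a) (hb : W `<=` zchart k b) :
  res (zcap_sub h ha) (s a + t a) =
    ratio d ha hb *: res (zcap_sub h hb) (s b + t b).
Proof. by rewrite !resD scalerDr -!tsecP. Qed.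

Definition tadd U (s t : twist_sec F d U) : twist_sec F d U :=
  TwistSec (tadd_subproof s t).

Lemma topp_subproof U (s : twist_sec F d U) (a b : 'I_n.+1) W (h : W `<=` U)
    (ha : W `<=` zchart k a) (hb : W `<=` zchart k b) :
  res (zcap_sub h ha) (- s a) = ratio d ha hb *: res (zcap_sub h hb) (- s b).
Proof. by rewrite !resN scalerN -!tsecP. Qed.

Definition topp U (s : twist_sec F d U) : twist_sec F d U :=
  TwistSec (topp_subproof s).

Lemma taddA U : associative (@tadd U).
Proof. by move=> s t u; apply: tsec_eq => a /=; rewrite addrA. Qed.

Lemma taddC U : commutative (@tadd U).
Proof. by move=> s t; apply: tsec_eq => a /=; rewrite addrC. Qed.

Lemma tadd0 U : left_id (@tzero U) (@tadd U).
Proof. by move=> s; apply: tsec_eq => a /=; rewrite add0r. Qed.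

Lemma taddN U : left_inverse (@tzero U) (@topp U) (@tadd U).
Proof. by move=> s; apply: tsec_eq => a /=; rewrite addNr. Qed.

HB.instance Definition _ U := GRing.isZmodule.Build (twist_sec F d U)
  (@taddA U) (@taddC U) (@tadd0 U) (@taddN U).

Lemma tscale_subproof U (c : oring U) (s : twist_sec F d U) (a b : 'I_n.+1) W
    (h : W `<=` U) (ha : W `<=` zchart k a) (hb : W `<=` zchart k b) :
  res (zcap_sub h ha) ((ores (@zcapl _ _ _ _) c : oring _) *: s a) =
    ratio d ha hb *:
      res (zcap_sub h hb) ((ores (@zcapl _ _ _ _) c : oring _) *: s b).
Proof.
rewrite !resZ !(@ores_comp _ _ _ _ _ _ _ _ h) (tsecP s h ha hb) !scalerA.
by rewrite mulrC.
Qed.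

Definition tscale U (c : oring U) (s : twist_sec F d U) : twist_sec F d U :=
  TwistSec (tscale_subproof c s).

Lemma tscaleA U (a b : oring U) (s : twist_sec F d U) :
  tscale a (tscale b s) = tscale (a * b) s.
Proof.
apply: tsec_eq => i /=; rewrite scalerA; congr (_ *: _).
exact: val_inj.
Qed.

Lemma tscale1 U : left_id 1 (@tscale U).
Proof.
move=> s; apply: tsec_eq => i /=; rewrite -[RHS]scale1r; congr (_ *: _).
exact: val_inj.
Qed.

Lemma tscaleDr U : right_distributive (@tscale U) +%R.
Proof. by move=> a s t; apply: tsec_eq => i /=; rewrite scalerDr. Qed.

Lemma tscaleDl U (s : twist_sec F d U) :
  {morph (@tscale U)^~ s : a b / a + b}.
Proof.
move=> a b; apply: tsec_eq => i /=; rewrite -scalerDl; congr (_ *: _).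
exact: val_inj.
Qed.

HB.instance Definition _ U := GRing.Zmodule_isLmodule.Build (oring U)
  (twist_sec F d U) (@tscaleA U) (@tscale1 U) (@tscaleDr U) (@tscaleDl U).

Lemma zcapS U W T : W `<=` U -> zcap W T `<=` zcap U T.
Proof. by move=> h v [/h]. Qed.

Lemma tres_subproof U V (l : V `<=` U) (s : twist_sec F d U) (a b : 'I_n.+1) W
    (h : W `<=` V) (ha : W `<=` zchart k a) (hb : W `<=` zchart k b) :
  res (zcap_sub h ha) (res (zcapS l) (s a)) =
    ratio d ha hb *: res (zcap_sub h hb) (res (zcapS l) (s b)).
Proof.
rewrite (res_comp _ _ (zcap_sub (subset_trans h l) ha)).
by rewrite (res_comp _ _ (zcap_sub (subset_trans h l) hb)) -tsecP.
Qed.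

Definition tres U V (l : V `<=` U) (s : twist_sec F d U) : twist_sec F d V :=
  TwistSec (tres_subproof l s).

Lemma tresD U V (l : V `<=` U) : {morph tres l : s t / s + t}.
Proof. by move=> s t; apply: tsec_eq => a /=; rewrite resD. Qed.

Lemma tresZ U V (l : V `<=` U) (c : oring U) (s : twist_sec F d U) :
  tres l (c *: s) = (ores l c : oring V) *: tres l s.
Proof.
apply: tsec_eq => a /=; rewrite resZ; congr (_ *: _).
by apply: val_inj; apply: funext => v /=; congr (sval c _); apply: val_inj.
Qed.

Lemma tres_id U (l : U `<=` U) (s : twist_sec F d U) : tres l s = s.
Proof. by apply: tsec_eq => a /=; rewrite res_id. Qed.

Lemma tres_comp U W T (h : W `<=` U) (h' : T `<=` W) (h'' : T `<=` U)
  (s : twist_sec F d U) : tres h' (tres h s) = tres h'' s.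
Proof. by apply: tsec_eq => a /=; rewrite (res_comp _ _ (zcapS h'')). Qed.

Lemma tres_glue U (I : Type) (W : I -> zopen k n) (h : forall i, W i `<=` U)
    (s : forall i, twist_sec F d (W i)) :
  zcover U W ->
  (forall i j T (hi : T `<=` W i) (hj : T `<=` W j),
     tres hi (s i) = tres hj (s j)) ->
  exists! t : twist_sec F d U, forall i, tres (h i) t = s i.
Proof.
move=> cov hs.
have covC T : T `<=` U -> zcover T (fun i => zcap (W i) T).
  by move=> TU v Tv; have [i Wv] := cov _ (TU _ Tv); exists i; split.
have ex a : exists! t : F (zcap U (zchart k a)),
    forall i, res (zcapS (h i)) t = s i a.
  apply: res_glue => [v [Uv av]|i j T hi hj].
    by have [i Wv] := cov _ Uv; exists i; split.
  have hT (l : 'I_n.+1) : T `<=` zchart k l -> T `<=` zcap T (zchart k l).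
    by move=> hl; apply: zcap_sub.
  have Ta : T `<=` zchart k a by move=> v /hi [].
  have hi' : T `<=` W i by move=> v /hi [].
  have hj' : T `<=` W j by move=> v /hj [].
  have := congr1 (fun u : twist_sec F d T => res (hT a Ta) (u a)) (hs i j T hi' hj').
  by rewrite /= (res_comp _ _ hi) (res_comp _ _ hj).
pose t a := projT1 (cid (ex a)).
have tP a : unique (fun t : F (zcap U (zchart k a)) =>
    forall i, res (zcapS (h i)) t = s i a) (t a) by rewrite /t; case: cid.
have tC (a b : 'I_n.+1) T (l : T `<=` U) (ha : T `<=` zchart k a)
    (hb : T `<=` zchart k b) :
    res (zcap_sub l ha) (t a) = ratio d ha hb *: res (zcap_sub l hb) (t b).
  apply: (res_sep (h := fun i => @zcapr _ _ (W i) T) (covC T l)) => i.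
  rewrite resZ.
  have lW := @zcapl _ _ (W i) T.
  have la : zcap (W i) T `<=` zchart k a by move=> v [_ /ha].
  have lb : zcap (W i) T `<=` zchart k b by move=> v [_ /hb].
  have E c (lc : zcap (W i) T `<=` zchart k c) (hc : T `<=` zchart k c) :
      res (@zcapr _ _ (W i) T) (res (zcap_sub l hc) (t c)) =
      res (zcap_sub lW lc) (s i c).
    have [/(_ i) <- _] := tP c.
    rewrite (res_comp _ _ (zcap_sub (subset_trans (@zcapr _ _ _ _) l) lc)).
    by rewrite (res_comp _ _ (zcap_sub (subset_trans (@zcapr _ _ _ _) l) lc)).
  rewrite (E a la) (E b lb) (tsecP (s i) lW la lb); congr (_ *: _).
  exact: val_inj.
exists (TwistSec tC); split=> [i|t' ht'].
  by apply: tsec_eq => a /=; case: (tP a).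
apply: tsec_eq => a /=; case: (tP a) => _; apply=> i.
by rewrite -ht'.
Qed.

Definition twist : omod k n := OMod tresD tresZ tres_id tres_comp tres_glue.

End Ops.

Section Morphisms.
Variables (F G : omod k n) (d : int) (f : omor F G).

Lemma twistm_subproof U (s : twist F d U) (a b : 'I_n.+1) W
    (h : W `<=` U) (ha : W `<=` zchart k a) (hb : W `<=` zchart k b) :
  res (zcap_sub h ha) (f _ (s a)) =
    ratio d ha hb *: res (zcap_sub h hb) (f _ (s b)).
Proof. by rewrite -!omor_nat (tsecP s h ha hb) linearZ. Qed.

Definition twistm_fun U (s : twist F d U) : twist G d U :=
  TwistSec (twistm_subproof s).

Lemma twistm_linear U : linear (@twistm_fun U).
Proof. by move=> c s t; apply: tsec_eq => a /=; rewrite linearP. Qed.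

HB.instance Definition _ U := GRing.isLinear.Build (oring U) (twist F d U)
  (twist G d U) *:%R (@twistm_fun U) (@twistm_linear U).

Lemma twistm_nat U W (h : W `<=` U) (s : twist F d U) :
  twistm_fun (res h s) = res h (twistm_fun s).
Proof. by apply: tsec_eq => a /=; rewrite omor_nat. Qed.

Definition twistm : omor (twist F d) (twist G d) :=
  @OMor k n (twist F d) (twist G d) (fun U => @twistm_fun U) twistm_nat.

End Morphisms.

End Twist.

(** [diff] takes the equation u = t + 1 as an argument, so that reindexing needs
    no transport between the types of [term (t + 1 + j)] and [term (t + j + 1)]. *)
Record complex (k : closedFieldType) (n : nat) := Complex {
  term :> int -> omod k n;
  diff : forall t u : int, u = t + 1 -> omor (term t) (term u);
  diff_diff : forall (t u w : int) (h : u = t + 1) (h' : w = u + 1)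
    (U : zopen k n) (s : term t U), diff h' U (diff h U s) = 0 }.

Definition acyclic (k : closedFieldType) (n : nat) (P : complex k n) : Prop :=
  forall (t u w : int) (h : u = t + 1) (h' : w = u + 1),
    oexact (diff P h) (diff P h').

Definition clinear (k : closedFieldType) (n : nat) (P : complex k n)
  (p : int -> nat) (r s : int) : Prop :=
  forall t : int, r <= t <= s -> oiso (P t) (osum (p t) (ostruct k n t)).

Section ComplexOps.
Variables (k : closedFieldType) (n : nat) (P : complex k n) (j : int).

Lemma cshift_subproof (t u : int) : u = t + 1 -> u + j = t + j + 1.
Proof. by move=> ->; rewrite addrAC. Qed.

Lemma cshift_diff_diff (t u w : int) (h : u = t + 1) (h' : w = u + 1)
  (U : zopen k n) (s : P (t + j) U) :
  diff P (cshift_subproof h') U (diff P (cshift_subproof h) U s) = 0.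
Proof. exact: diff_diff. Qed.

(** P[j], with P[j]_t = P_(t + j) and no sign on the differentials. *)
Definition cshift : complex k n :=
  @Complex k n (fun t => P (t + j)) (fun t u h => diff P (cshift_subproof h))
    cshift_diff_diff.

Lemma ctwist_diff_diff (t u w : int) (h : u = t + 1) (h' : w = u + 1)
  (U : zopen k n) (s : twist (P t) j U) :
  twistm j (diff P h') U (twistm j (diff P h) U s) = 0.
Proof. by apply: tsec_eq => a /=; rewrite diff_diff. Qed.

Definition ctwist : complex k n :=
  @Complex k n (fun t => twist (P t) j) (fun t u h => twistm j (diff P h))
    ctwist_diff_diff.

End ComplexOps.

Record cmor (k : closedFieldType) (n : nat) (P Q : complex k n) := CMor {
  cmor_fun :> forall t : int, omor (P t) (Q t);
  cmor_diff : forall (t u : int) (h : u = t + 1) (U : zopen k n) (s : P t U),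
    cmor_fun u U (diff P h U s) = diff Q h U (cmor_fun t U s) }.

(** ker f = B (x) O(e) for a vector space B of dimension b; this is what the
    "dimension of ker f" means for a morphism f : F -> G given by a matrix of
    scalars, i.e. a linear map tensored with O(e), B being the kernel of that
    linear map. *)
Definition dim_ker (k : closedFieldType) (n : nat) (F G : omod k n)
  (f : omor F G) (e : int) (b : nat) : Prop :=
  exists iota : omor (osum b (ostruct k n e)) F, is_okernel iota f.

(** p_m - p_(m+1) + p_(m+2) - ... up to degree 0, the sum from k = 0 to k = -m;
    empty when m > 0. *)
Definition altsum (p : int -> nat) (m : int) : int :=
  \sum_(k < (if m <= 0 then `|m|%N.+1 else 0%N)) (-1) ^+ k * (p (m + k%:Z))%:Z.

Definition linear_matrix (k : closedFieldType) (n b c : nat)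
  (M : 'M[{mpoly k[n.+1]}]_(b, c)) : Prop := forall i l, M i l \is 1.-homog.

Definition constant_rank (k : closedFieldType) (n b c : nat)
  (M : 'M[{mpoly k[n.+1]}]_(b, c)) (r : int) : Prop :=
  forall v : 'rV[k]_n.+1, v != 0 -> (\rank (map_mx (meval (v ord0)) M))%:Z = r.

(* Main.v *)
(** At a point v, an acyclic bounded complex of vector bundles has local lifts of
    kernels that are linear over the structure sheaf (half of a contracting
    homotopy), hence remains exact on fibres; so the differential into degree
    i + 2 has rank altsum p (i + 2), and similarly for Q.

    Global sections of O are constants and those of O(1) are linear forms (restrict
    to lines).  Hence phi_(i+1) is a constant matrix A of full rank, whose kernel is
    O(i+1)^c with c = p_(i+1) - q_(i+j+1), given by a constant matrix N.  The
    differential d of P maps it to ker phi_(i+2) = O(i+2)^b, by a matrix of linear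
    forms L with L I = N d, where I is the inclusion of the kernel in P_(i+2).  On
    the fibre at v, linear algebra and the surjectivity of phi_i and phi_(i+1) give
    rank (N d) = rank d_P - rank d_Q.

    The inclusion I of sheaves need not be injective on fibres, so this only bounds
    the rank of L(v) from below.  For the equality, a vector x with x N d(v) = 0 is
    the value of a local section of O(i+1)^c that is killed by N d, hence by L. *)
Require Import Defs.
From HB Require Import structures.
From mathcomp Require Import all_boot all_order all_algebra.
From mathcomp Require Import mpoly zify.
From mathcomp Require Import boolp classical_sets functions.

Set Implicit Arguments.
Unset Strict Implicit.
Unset Printing Implicit Defensive.

Import Order.TTheory GRing.Theory Num.Theory.
Local Open Scope ring_scope.
Local Open Scope classical_set_scope.

(** * Polynomials and rational functions over a closed field *)

Section ClosedFieldPoly.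
Variable k : closedFieldType.

(** If p were nonzero, [p * 'X + 1] would be nonconstant and so have a root, yet its value there
    would be 1. *)
Lemma poly_eval0 (p : {poly k}) : (forall x, p.[x] = 0) -> p = 0.
Proof.
move=> p0; apply/eqP/negPn/negP => pN0.
have : size (p * 'X + 1%:P) != 1 by rewrite size_MXaddC (negPf pN0) /= eqSS size_poly_eq0.
move=> /closed_rootP[x /rootP].
by rewrite hornerMXaddC p0 mul0r add0r => /eqP; rewrite oner_eq0.
Qed.

(** Every local fraction equals the reduced form [A1 / B1] of the fraction at 0. As [B1] divides
    each local denominator it has no root, hence is constant. *)
Lemma poly_locally_rational (g : k -> k) :
  (forall x, exists A B : {poly k},
    B.[x] != 0 /\ forall y, B.[y] != 0 -> g y = A.[y] / B.[y]) ->
  exists p : {poly k}, forall x, g x = p.[x].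
Proof.
move=> hg; have [A [B [B0 hAB]]] := hg 0.
have BN0 : B != 0 by apply: contraNneq B0 => ->; rewrite horner0.
have dN0 : gcdp A B != 0 by rewrite gcdp_eq0 (negPf BN0) andbF.
pose A1 := A %/ gcdp A B; pose B1 := B %/ gcdp A B.
have EA : A = A1 * gcdp A B by rewrite divpK // dvdp_gcdl.
have EB : B = B1 * gcdp A B by rewrite divpK // dvdp_gcdr.
have cop : coprimep B1 A1.
  by rewrite coprimep_sym coprimep_div_gcd // BN0 orbT.
have key x : exists C D : {poly k},
    [/\ D.[x] != 0, g x = C.[x] / D.[x] & A1 * D = C * B1].
  have [C [D [Dx hCD]]] := hg x; exists C, D; split=> //; first exact: hCD.
  apply: (mulIf dN0); rewrite mulrAC -EA -mulrA -EB.
  (* The two fractions can be compared only where [B * D] does not vanish; the extra factor [B * D]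
     covers the other points. *)
  have /poly_eval0/eqP : forall y, ((A * D - C * B) * (B * D)).[y] = 0.
    move=> y; rewrite hornerM; have [->|] := eqVneq (B * D).[y] 0; first by rewrite mulr0.
    rewrite hornerM mulf_eq0 negb_or => /andP[By Dy].
    have := hAB y By; rewrite hCD // => /eqP.
    rewrite eqr_div // => /eqP E.
    by rewrite hornerD hornerN ![(_ * _).[y]]hornerM E subrr mul0r.
  rewrite mulf_eq0 mulf_eq0 (negPf BN0) /= subr_eq0.
  have /negPf -> : D != 0 by apply: contraNneq Dx => ->; rewrite horner0.
  by rewrite orbF => /eqP.
have : size B1 == 1.
  apply/negPn/negP => /closed_rootP[x /rootP B1x].
  have [C [D [Dx _ E]]] := key x.
  have /dvdpP[q Eq] : B1 %| D by rewrite -(Gauss_dvdpr _ cop) E dvdp_mull.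
  by move: Dx; rewrite Eq hornerM B1x mulr0 eqxx.
move=> /size_poly1P[c cN0 Ec]; exists (c^-1 *: A1) => x.
have [C [D [Dx -> E]]] := key x.
apply: (canLR (mulfK Dx)); move/(congr1 (horner^~ x)): E.
by rewrite Ec !hornerE => E; rewrite -mulrA E mulrCA mulVf // mulr1.
Qed.

(** With [R] the reversal of h, the hypothesis becomes the identity g X^m = X^e R, which yields both
    the coefficients of g and its degree bound. *)
Lemma reversed_poly_coef (e : nat) (g h : {poly k}) :
  (forall x, x != 0 -> g.[x] = x ^+ e * h.[x^-1]) ->
  (forall j, (j <= e)%N -> g`_j = h`_(e - j)) /\ (size g <= e.+1)%N.
Proof.
move=> hgh; pose m := size h; pose R := \poly_(i < m.+1) h`_(m - i).
have ER : g * 'X^m = 'X^e * R.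
  (* The additional factor X settles y = 0, where the hypothesis gives nothing. *)
  apply/eqP; rewrite -subr_eq0; have /poly_eval0/eqP :
      forall y, ((g * 'X^m - 'X^e * R) * 'X).[y] = 0.
    move=> y; rewrite hornerM hornerX.
    have [->|y0] := eqVneq y 0; first by rewrite mulr0.
    rewrite !hornerE hgh // horner_poly (horner_coef_wide (n:=m.+1)) //.
    rewrite -mulrA -mulrBr mulr_suml (reindex_inj rev_ord_inj) /= -sumrB.
    rewrite big1 ?mulr0 ?mul0r // => i _.
    have im : (i <= m)%N by rewrite -ltnS.
    rewrite subSS -mulrA -[in y ^+ m](subnK im) exprD exprVn mulKf ?expf_neq0 //.
    by rewrite subrr.
  by rewrite mulf_eq0 polyX_eq0 orbF.
have coefE j : g`_j = if (j + m < e)%N then 0 else R`_(j + m - e).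
  have := congr1 (fun p : {poly k} => p`_(j + m)) ER.
  by rewrite coefMXn coefXnM ltnNge leq_addl addnK.
split=> [j je|].
  rewrite coefE; case: ltnP => jm.
    rewrite nth_default // leq_subRL //; exact: ltnW.
  rewrite coef_poly ifT; last by rewrite ltnS leq_subLR leq_add2r.
  by congr (h`_ _); rewrite subnBA // [X in (X - _)%N]addnC subnDr.
apply/leq_sizeP => j ej; rewrite coefE ltnNge (leq_trans (ltnW ej)) ?leq_addr //=.
by rewrite coef_poly ltnS leq_subLR leq_add2r leqNgt ej.
Qed.

End ClosedFieldPoly.

(** * Polynomials under scaling and along lines *)

Section MevalExtra.
Variables (k : closedFieldType) (n : nat).
Implicit Types (F G : {mpoly k[n.+1]}) (u v w : 'rV[k]_n.+1).

Lemma dhomog_mevalZ d F (c : k) v : F \is d.-homog ->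
  F.@[(c *: v) ord0] = c ^+ d * F.@[v ord0].
Proof.
move=> /dhomogP hF; rewrite !mevalE mulr_sumr; apply: eq_big_seq => m mF.
rewrite mulrCA; congr (_ * _).
have <- : mdeg m = d by exact: hF.
rewrite mdegE -prodrXr -big_split /=.
by apply: eq_bigr => i _; rewrite mxE exprMn.
Qed.

Lemma meval_line F u w : exists p : {poly k},
  forall t, p.[t] = F.@[(u + t *: w) ord0].
Proof.
exists (\sum_(m <- msupp F) F@_m *: \prod_i ((u ord0 i)%:P + w ord0 i *: 'X) ^+ m i) => t.
rewrite mevalE horner_sum; apply: eq_bigr => m _.
rewrite hornerZ horner_prod; congr (_ * _); apply: eq_bigr => i _.
by rewrite !hornerE !mxE mulrC.
Qed.

End MevalExtra.

(** * Sections of O(e) as functions on the cone *)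

Section Values.
Variables (k : closedFieldType) (n : nat).
Implicit Types (U W : zopen k n) (u v w : 'rV[k]_n.+1).

Definition zpt U v (Uv : zset U v) : zset U := SigSub (mem_set Uv).

Lemma zptK U (v : zset U) (Uv : zset U (val v)) : zpt Uv = v.
Proof. exact: val_inj. Qed.

(* Junk value 0 outside of the open set. *)
Definition oval e U (s : osec e U) v : k :=
  match pselect (zset U v) with left Uv => val s (zpt Uv) | right _ => 0 end.

Lemma ovalE e U (s : osec e U) v (Uv : zset U v) : oval s v = val s (zpt Uv).
Proof.
rewrite /oval; case: pselect => // Uv'; congr (sval s _); exact: val_inj.
Qed.

Lemma oval_ext e U (s t : osec e U) :
  (forall v, zset U v -> oval s v = oval t v) -> s = t.
Proof.
move=> st; apply: val_inj; apply: funext => v.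
have Uv := set_mem (valP v); have := st _ Uv.
by rewrite !(ovalE _ Uv) zptK.
Qed.

Lemma oval_res e U W (h : W `<=` U) (s : osec e U) v : zset W v ->
  oval (ores h s) v = oval s v.
Proof.
move=> Wv; rewrite (ovalE _ Wv) (ovalE _ (h v Wv)) /=.
by congr (sval s _); apply: val_inj.
Qed.

Lemma oval0 e U v : oval (0 : osec e U) v = 0.
Proof. by rewrite /oval; case: pselect. Qed.

Lemma ovalD e U (s t : osec e U) v : oval (s + t) v = oval s v + oval t v.
Proof. by rewrite /oval; case: pselect => // _; rewrite addr0. Qed.

Lemma oval_sum e U (I : finType) (s : I -> osec e U) v :
  oval (\sum_i s i) v = \sum_i oval (s i) v.
Proof. exact: (big_morph (fun s => oval s v) (fun s t => ovalD s t v) (oval0 _ _ _)). Qed.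

Lemma ovalZ e U (a : oring U) (s : osec e U) v :
  oval (a *: s) v = oval a v * oval s v.
Proof. by rewrite /oval; case: pselect => // _; rewrite mulr0. Qed.

Lemma ovalM U (a b : oring U) v : oval (a * b) v = oval a v * oval b v.
Proof. by rewrite /oval; case: pselect => // _; rewrite mulr0. Qed.

(* Restatements of [oval0] and [ovalD] for the ring structure of O(U), which
   rewriting does not identify with the module structure of O(0)(U). *)
Lemma oring_oval0 U v : oval (0 : oring U) v = 0.
Proof. exact: (oval0 0 U v). Qed.

Lemma oring_ovalD U (a b : oring U) v : oval (a + b) v = oval a v + oval b v.
Proof. exact: (@ovalD 0 U a b v). Qed.

Lemma oval1 U v : zset U v -> oval (1 : oring U) v = 1.
Proof. by move=> Uv; rewrite (ovalE _ Uv). Qed.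

Lemma oval_delta p U (i l : 'I_p) v : zset U v ->
  oval ((i == l)%:R : oring U) v = (i == l)%:R :> k.
Proof. by case: eqP => _ Uv; [rewrite oval1|rewrite oring_oval0]. Qed.

Lemma osec_exists e U (f : 'rV[k]_n.+1 -> k) : @regular k n e U (f \o val) ->
  exists s : osec e U, forall v, zset U v -> oval s v = f v.
Proof.
move=> /asboolP hf; exists (exist (fun g => regularb e g) _ hf) => v Uv.
by rewrite (ovalE _ Uv).
Qed.

Lemma oval_regular e U (s : osec e U) : @regular k n e U (oval s \o val).
Proof.
suff -> : oval s \o val = val s by exact: (asboolW (valP s)).
by apply: funext => v /=; rewrite (ovalE _ (set_mem (valP v))) zptK.
Qed.

Lemma oconst_exists U (c : k) :
  exists s : oring U, forall v, zset U v -> oval s v = c.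
Proof.
apply: (@osec_exists 0 U (fun=> c)) => v; exists 0%N, 0%N, (c *: 1), 1.
split; rewrite ?dhomog1 ?meval1 ?oner_eq0 //; first exact/rpredZ/dhomog1.
by move=> w _; rewrite mevalZ meval1 mulr1 divr1.
Qed.

Lemma coord_pow_regular (a : 'I_n.+1) (d : int) U : U `<=` zchart k a ->
  @regular k n d U (fun v : zset U => val v ord0 a ^ d).
Proof.
move=> Ua v; have nz (w : zset U) : val w ord0 a != 0.
  by have [_] := Ua _ (set_mem (valP w)); rewrite mevalXU.
have Xm m : ('X_a ^+ m : {mpoly k[n.+1]}) \is m.-homog.
  have X1 : ('X_a : {mpoly k[n.+1]}) \is 1.-homog by rewrite dhomogX /= mdeg1.
  by have := dhomogMn m X1; rewrite mul1n.
case: d => m.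
  exists m, 0%N, ('X_a ^+ m), 1.
  split; rewrite ?dhomog1 ?meval1 ?oner_eq0 ?Xm ?addr0 ?add0r // => w _.
  by rewrite meval1 divr1 rmorphXn /= mevalXU.
exists 0%N, m.+1, 1, ('X_a ^+ m.+1); split; rewrite ?dhomog1 ?NegzE ?subrr ?Xm //.
  by rewrite rmorphXn /= mevalXU expf_neq0 ?nz.
by move=> w _; rewrite meval1 rmorphXn /= mevalXU -exprnN mul1r.
Qed.

Lemma ztop_subproof v : [set v | v != 0] v -> exists (e : nat) (G : {mpoly k[n.+1]}),
  [/\ G \is e.-homog, basic_open G v & basic_open G `<=` [set v | v != 0]].
Proof.
move=> v0; exists 0%N, 1; split; rewrite ?dhomog1 //; last by move=> w [].
by split=> //; rewrite meval1 oner_eq0.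
Qed.

Definition ztop := Zopen ztop_subproof.

Lemma zset_neq0 U v : zset U v -> v != 0.
Proof. by move=> /zsetP[e [G [_ []]]]. Qed.

Lemma chart_neq0 (a : 'I_n.+1) v : zset (zchart k a) v -> v ord0 a != 0.
Proof. by move=> []; rewrite mevalXU. Qed.

Lemma chartP (a : 'I_n.+1) v : v ord0 a != 0 -> zset (zchart k a) v.
Proof.
move=> va; split; last by rewrite mevalXU.
by apply: contra_neq va => ->; rewrite mxE.
Qed.

Lemma exists_chart v : v != 0 -> exists a, zset (zchart k a) v.
Proof. by move=> /rV0Pn[a /chartP]; exists a. Qed.

(** Local sections with the values of one function f agree on overlaps automatically. Gluing over
    all such sections at once avoids choosing one at each point. *)
Lemma osec_glue e U (f : 'rV[k]_n.+1 -> k) :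
  (forall v, zset U v -> exists (W : zopen k n) (s : osec e W),
     [/\ zset W v, W `<=` U & forall w, zset W w -> oval s w = f w]) ->
  exists s : osec e U, forall v, zset U v -> oval s v = f v.
Proof.
move=> hf; pose I := {Ws : {W : zopen k n & osec e W} | projT1 Ws `<=` U /\
  forall w, zset (projT1 Ws) w -> oval (projT2 Ws) w = f w}.
have [||t [ht _]] := @ores_glue k n e U I (fun i => projT1 (sval i))
    (fun i => (svalP i).1) (fun i => projT2 (sval i)).
- by move=> v /hf[W [s [Wv WU hs]]]; exists (exist _ (existT _ W s) (conj WU hs)).
- move=> i j T hi hj; apply: oval_ext => v Tv; rewrite !oval_res //.
  by rewrite (svalP i).2 ?(svalP j).2 //; [exact: hj|exact: hi].
exists t => v /hf[W [s [Wv WU hs]]].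
rewrite -hs //; have /= := ht (exist _ (existT _ W s) (conj WU hs)).
by move=> <-; rewrite oval_res.
Qed.

End Values.

(** * Global sections of O and O(1) *)

Section GlobalSections.
Variables (k : closedFieldType) (n : nat).
Implicit Types (u v w : 'rV[k]_n.+1).

Lemma oval_fraction e (s : osec e (ztop k n)) v : v != 0 ->
  exists (c d : nat) (F G : {mpoly k[n.+1]}),
    [/\ F \is c.-homog, G \is d.-homog, c%:Z = d%:Z + e, G.@[v ord0] != 0
      & forall w, w != 0 -> G.@[w ord0] != 0 ->
          oval s w = F.@[w ord0] / G.@[w ord0]].
Proof.
move=> v0; have [c [d [F [G [hF hG E Gv hs]]]]] := oval_regular s (@zpt k n (ztop k n) v v0).
by exists c, d, F, G; split=> // w w0; apply: (hs (@zpt k n (ztop k n) w w0)).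
Qed.

(** One homogeneous fraction F / G computes the values at both v and [c *: v], and its degree is
    e. *)
Lemma oval_scale (e : nat) (s : osec e (ztop k n)) (c : k) v : c != 0 -> v != 0 ->
  oval s (c *: v) = c ^+ e * oval s v.
Proof.
move=> c0 v0; have [a [d [F [G [hF hG /eqP E Gv hs]]]]] := oval_fraction s v0.
have cv0 : c *: v != 0 by rewrite scaler_eq0 negb_or c0.
move: E; rewrite -PoszD eqz_nat => /eqP E.
rewrite !hs //; last by rewrite (dhomog_mevalZ _ _ hG) mulf_neq0 ?expf_neq0.
rewrite (dhomog_mevalZ _ _ hF) (dhomog_mevalZ _ _ hG) E exprD.
by rewrite invfM mulrACA [c ^+ d * _]mulrC mulfK ?expf_neq0 // mulrA.
Qed.

Lemma oval_line e (s : osec e (ztop k n)) u w : (forall t, u + t *: w != 0) ->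
  exists p : {poly k}, forall t, oval s (u + t *: w) = p.[t].
Proof.
move=> uw; apply: poly_locally_rational => x.
have [c [d [F [G [_ _ _ Gx hs]]]]] := oval_fraction s (uw x).
have [A hA] := meval_line F u w; have [B hB] := meval_line G u w.
by exists A, B; rewrite hB; split=> // y; rewrite hA hB => /(hs _ (uw y)).
Qed.

(* The two polynomials are the dehomogenisations of the restriction of [s] to
   the projective line through u and w. *)
Lemma oval_plane (e : nat) (s : osec e (ztop k n)) u w :
  u != 0 -> (forall c, w != c *: u) ->
  exists p q : {poly k}, [/\ forall t, oval s (u + t *: w) = p.[t],
    forall t, oval s (w + t *: u) = q.[t],
    forall j, (j <= e)%N -> p`_j = q`_(e - j) & (size p <= e.+1)%N].
Proof.
move=> u0 hw.
have uw t : u + t *: w != 0.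
  have [->|t0] := eqVneq t 0; first by rewrite scale0r addr0.
  apply/eqP => E; case/eqP: (hw (- t^-1)); apply: (scalerI t0).
  by rewrite scalerA mulrN divff // scaleN1r; apply/eqP; rewrite -addr_eq0 addrC E.
have wu t : w + t *: u != 0 by rewrite addr_eq0 -scaleNr.
have [p hp] := oval_line s uw; have [q hq] := oval_line s wu.
have [|hpq sp] := @reversed_poly_coef k e p q; last by exists p, q.
move=> x x0; rewrite -hp -hq -oval_scale // scalerDr scalerA divff // scale1r.
by rewrite addrC.
Qed.

(** Along a fixed vector u this is homogeneity of degree 0. For v off the line of u, [oval_plane]
    with e = 0 identifies the constant terms, which are the values at u and v. *)
Lemma ztop_osec0_const (s : osec 0 (ztop k n)) :
  exists c, forall v, v != 0 -> oval s v = c.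
Proof.
pose u : 'rV[k]_n.+1 := delta_mx 0 0; exists (oval s u) => v v0.
have u0 : u != 0 by apply/eqP => /rowP/(_ 0)/eqP; rewrite !mxE !eqxx oner_eq0.
have [[c hc]|hc] := pselect (exists c, v = c *: u).
  rewrite hc (oval_scale (e:=0)) ?mul1r //.
  by apply: contraNneq v0 => c0; rewrite hc c0 scale0r.
have [|p [q [hp hq hpq _]]] := @oval_plane 0 s u v u0.
  by move=> c; apply/eqP => E; apply: hc; exists c.
have := hq 0; have := hp 0; rewrite !scale0r !addr0 => -> ->.
by rewrite !horner_coef0 hpq.
Qed.

(** Extended by 0 at the origin, s is additive: on the plane of u and w the polynomial p has degree
    at most 1, so the value at u + w is p_0 + p_1, where p_0 is the value at u and p_1 = q_0 the
    value at w. *)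
Lemma ztop_osec1_linear (s : osec 1 (ztop k n)) :
  exists F : {mpoly k[n.+1]}, F \is 1.-homog /\
    forall v, v != 0 -> oval s v = F.@[v ord0].
Proof.
pose f v : k := if v == 0 then 0 else oval s v.
have fZ c v : f (c *: v) = c * f v.
  have [->|c0] := eqVneq c 0; first by rewrite scale0r mul0r /f eqxx.
  rewrite /f scaler_eq0 (negPf c0) /=; case: eqVneq => [_|v0]; first by rewrite mulr0.
  by rewrite (oval_scale (e:=1)).
have fD u w : f (u + w) = f u + f w.
  have [->|u0] := eqVneq u 0; first by rewrite add0r {2}/f eqxx add0r.
  have [[c ->]|hc] := pselect (exists c, w = c *: u).
    by rewrite -{1}[u]scale1r -scalerDl !fZ mulrDl mul1r.
  have hw c : w != c *: u by apply/eqP => E; apply: hc; exists c.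
  have [p [q [hp hq hpq sp]]] := @oval_plane 1 s u w u0 hw.
  have w0 : w != 0 by have := hw 0; rewrite scale0r.
  have uw0 : u + w != 0 by rewrite addrC addr_eq0 -scaleN1r.
  rewrite /f (negPf u0) (negPf w0) (negPf uw0).
  have := hp 1; have := hp 0; have := hq 0; rewrite !scale0r !addr0 scale1r.
  move=> -> -> ->; rewrite !horner_coef0 (horner_coef_wide _ sp).
  by rewrite !big_ord_recl big_ord0 /= !mulr1 addr0 (hpq 1%N).
have f0 : f 0 = 0 by rewrite /f eqxx.
exists (\sum_i f (delta_mx 0 i) *: 'X_i); split.
  apply: rpred_sum => i _; apply: rpredZ.
  by rewrite dhomogX /= mdeg1.
move=> v v0; have -> : oval s v = f v by rewrite /f (negPf v0).
rewrite {1}[v]row_sum_delta (big_morph f fD f0) rmorph_sum /=.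
by apply: eq_bigr => i _; rewrite fZ mevalZ mevalXU mulrC.
Qed.

End GlobalSections.

(** * Morphisms of sheaves, frames and fibres *)

Section Sheaves.
Variables (k : closedFieldType) (n : nat).
Implicit Types (U W T : zopen k n) (v : 'rV[k]_n.+1) (F G H : omod k n).

Lemma omor_exists F G (f : forall U, F U -> G U) :
  (forall U, linear (f U)) ->
  (forall U W (h : W `<=` U) s, f W (res h s) = res h (f U s)) ->
  exists g : omor F G, forall U s, g U s = f U s.
Proof.
move=> flin fnat.
pose L U : {linear F U -> G U} :=
  HB.pack (f U) (GRing.isLinear.Build _ _ _ _ (f U) (flin U)).
by exists (@OMor _ _ F G L fnat).
Qed.

Lemma omor_comp F G H (f : omor F G) (g : omor G H) :
  exists gf : omor F H, forall U s, gf U s = g U (f U s).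
Proof.
apply: omor_exists => [U a s t|U W h s]; first by rewrite !linearP.
by rewrite !omor_nat.
Qed.

Lemma omor_inv F G (f : omor F G) : (forall U, bijective (f U)) ->
  exists g : omor G F, forall U, cancel (f U) (g U) /\ cancel (g U) (f U).
Proof.
move=> fbij; have inv U : {g : G U -> F U | cancel (f U) g /\ cancel g (f U)}.
  by apply: cid; case: (fbij U) => g fK gK; exists g.
have fK U := (svalP (inv U)).1; have gK U := (svalP (inv U)).2.
have [||g hg] := @omor_exists G F (fun U => sval (inv U)).
- by move=> U a s t; apply: (can_inj (fK U)); rewrite gK linearP !gK.
- by move=> U W h s; apply: (can_inj (fK W)); rewrite gK omor_nat gK.
by exists g => U; split=> s; rewrite hg ?fK ?gK.
Qed.

(** Lifts through [iota] are unique, so the chosen ones are linear and compatible with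
    restriction. *)
Lemma omor_kernel_lift F G H E (iota : omor F G) (g : omor G H) (f : omor E G) :
  is_okernel iota g -> (forall U s, g U (f U s) = 0) ->
  exists f' : omor E F, forall U s, iota U (f' U s) = f U s.
Proof.
move=> ker gf; have lift U s : {t | iota U t = f U s}.
  by apply: cid; apply/(ker U).2.
have [l lP] : exists l : forall U, E U -> F U, forall U s, iota U (l U s) = f U s.
  by exists (fun U s => sval (lift U s)) => U s; exact: svalP (lift U s).
have [||f' hf'] := @omor_exists E F l.
- by move=> U a s t; apply: (ker U).1; rewrite linearP !lP linearP.
- by move=> U W h s; apply: (ker W).1; rewrite omor_nat !lP omor_nat.
by exists f' => U s; rewrite hf'.
Qed.

Lemma section_eq_local F U (s t : F U) :
  (forall v, zset U v -> exists W (h : W `<=` U), zset W v /\ res h s = res h t) ->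
  s = t.
Proof.
move=> st; pose I := {W : zopen k n | exists h : W `<=` U, res h s = res h t}.
have sub (i : I) : sval i `<=` U by have [] := svalP i.
apply: (@res_sep _ _ F U I (fun i => sval i) sub) => [v /st[W [h [Wv hst]]]|i].
  by exists (exist _ W (ex_intro _ h hst)).
have [h hst] := svalP i.
by rewrite (Prop_irrelevance (sub i) h).
Qed.

Lemma res_sum F U W (h : W `<=` U) (I : finType) (s : I -> F U) :
  res h (\sum_i s i) = \sum_i res h (s i).
Proof. exact: (big_morph (@res _ _ F U W h) (@resD _ _ F U W h) (res0 F h)). Qed.

Lemma res_lincomb F U W (h : W `<=` U) (I : finType) (a : I -> oring U)
    (s : I -> F U) :
  res h (\sum_i a i *: s i) = \sum_i (ores h (a i) : oring W) *: res h (s i).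
Proof. by rewrite res_sum; apply: eq_bigr => i _; rewrite resZ. Qed.

Lemma omor_lincomb F G (f : omor F G) U (I : finType) (a : I -> oring U)
    (s : I -> F U) :
  f U (\sum_i a i *: s i) = \sum_i a i *: f U (s i).
Proof. by rewrite linear_sum; apply: eq_bigr => i _; rewrite linearZ. Qed.

Definition frame F r U (e : 'I_r -> F U) : Prop :=
  forall W (h : W `<=` U) (s : F W),
    exists! a : {ffun 'I_r -> oring W}, s = \sum_i a i *: res h (e i).

Lemma frame_free F r U (e : 'I_r -> F U) W (h : W `<=` U) (a : 'I_r -> oring W) :
  frame e -> \sum_i a i *: res h (e i) = 0 -> forall i, a i = 0.
Proof.
move=> fe a0 i; have [b [_ ub]] := fe W h 0.
have /ffunP/(_ i) : [ffun i => a i] = [ffun=> 0].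
  rewrite -(ub [ffun i => a i]) ?(ub [ffun=> 0]) //.
    by rewrite big1 // => l _; rewrite ffunE scale0r.
  by rewrite -[LHS]a0; apply: eq_bigr => l _; rewrite ffunE.
by rewrite !ffunE.
Qed.

(** [ev] is the evaluation of sections in the fibre F(v), identified with k^r. *)
Record fibre F v r (ev : forall U, F U -> 'rV[k]_r) : Prop := Fibre {
  fibre_lin : forall U, zset U v -> forall (a : oring U) (s t : F U),
    ev U (a *: s + t) = oval a v *: ev U s + ev U t;
  fibre_res : forall U W (h : W `<=` U) (s : F U), zset W v ->
    ev W (res h s) = ev U s;
  fibre_frame : exists U (e : 'I_r -> F U),
    [/\ zset U v, frame e & forall i, ev U (e i) = delta_mx 0 i] }.

Section FibreTheory.
Variables (F : omod k n) (v : 'rV[k]_n.+1) (r : nat).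
Variable (ev : forall U, F U -> 'rV[k]_r).
Hypothesis fev : fibre v ev.

Lemma fibreD U (s t : F U) : zset U v -> ev (s + t) = ev s + ev t.
Proof.
by move=> Uv; have := fibre_lin fev Uv 1 s t; rewrite !scale1r oval1 // scale1r.
Qed.

Lemma fibre0 U : zset U v -> ev (0 : F U) = 0.
Proof.
by move=> Uv; apply: (addrI (ev (0 : F U))); rewrite -fibreD // !addr0.
Qed.

Lemma fibreZ U (a : oring U) (s : F U) : zset U v -> ev (a *: s) = oval a v *: ev s.
Proof.
by move=> Uv; have := fibre_lin fev Uv a s 0; rewrite !addr0 fibre0 // addr0.
Qed.

Lemma fibre_sum U (I : finType) (s : I -> F U) : zset U v ->
  ev (\sum_i s i) = \sum_i ev (s i).
Proof.
by move=> Uv; apply: (big_morph _ (fun s t => fibreD s t Uv) (fibre0 Uv)).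
Qed.

Lemma fibre_lincomb U (e : 'I_r -> F U) (a : 'I_r -> oring U) : zset U v ->
  (forall i, ev (e i) = delta_mx 0 i) ->
  ev (\sum_i a i *: e i) = \row_i oval (a i) v.
Proof.
move=> Uv he; rewrite fibre_sum // [RHS]row_sum_delta.
by apply: eq_bigr => i _; rewrite fibreZ // he mxE.
Qed.

Lemma fibreB U (s t : F U) : zset U v -> ev (s - t) = ev s - ev t.
Proof.
by move=> Uv; apply: (addIr (ev t)); rewrite -fibreD // !subrK.
Qed.

Lemma fibre_lift (x : 'rV[k]_r) : exists U (s : F U), zset U v /\ ev s = x.
Proof.
have [U [e [Uv _ he]]] := fibre_frame fev.
pose c i := sval (cid (oconst_exists U (x 0 i))).
exists U, (\sum_i c i *: e i); split=> //.
rewrite fibre_lincomb //; apply/rowP => i; rewrite mxE.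
by rewrite /c; case: cid => /= a ->.
Qed.

End FibreTheory.

(** Restrict a section to the domain of a frame around v, take its coordinates there, and evaluate
    them at v. *)
Lemma vbundle_fibre F r v : vbundle F r -> v != 0 ->
  exists ev : forall U, F U -> 'rV[k]_r, fibre v ev.
Proof.
move=> bF v0; have [U [e [Uv fe]]] := bF v v0.
pose co W (s : F W) := sval (cid (fe _ (@zcapr _ _ W U) (res (@zcapl _ _ W U) s))).
have coP W s : res (@zcapl _ _ W U) s = \sum_i co W s i *: res (@zcapr _ _ W U) (e i).
  by rewrite /co; case: cid => a [].
pose ev W (s : F W) := \row_i oval (co W s i) v.
(* The coordinates may be computed on any smaller neighbourhood of v. *)
have evE W s T (hW : T `<=` W) (hU : T `<=` U) (a : 'I_r -> oring T) :
    zset T v -> res hW s = \sum_i a i *: res hU (e i) -> ev W s = \row_i oval (a i) v.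
  move=> Tv sa; apply/rowP => i; rewrite !mxE -(oval_res (zcap_sub hW hU)) //.
  congr (oval _ v).
  have [b [_ ub]] := fe T hU (res hW s).
  have /ffunP/(_ i) : [ffun i => ores (zcap_sub hW hU) (co W s i)] = [ffun i => a i].
    rewrite -(ub [ffun i => a i]); last first.
      by rewrite sa; apply: eq_bigr => l _; rewrite ffunE.
    symmetry; apply: ub; rewrite -(res_comp (@zcapl _ _ W U) (zcap_sub hW hU)) coP.
    rewrite res_lincomb; apply: eq_bigr => l _; rewrite ffunE.
    by rewrite (res_comp _ _ hU).
  by rewrite !ffunE.
exists ev; split.
- move=> W Wv a s t.
  rewrite (evE _ _ _ (@zcapl _ _ W U) (@zcapr _ _ W U)
    (fun i => (ores (@zcapl _ _ W U) a : oring (zcap W U)) * co W s i + co W t i))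
    //; first last.
  + rewrite resD resZ !coP scaler_sumr -big_split /=; apply: eq_bigr => i _.
    by rewrite scalerDl scalerA.
  apply/rowP => i; rewrite !mxE oring_ovalD; congr (_ + _).
  by rewrite ovalM oval_res //; split.
- move=> W T h s Tv.
  rewrite (evE T _ (zcap T U) (@zcapl _ _ T U) (@zcapr _ _ T U)
     (fun i => ores (@zcapS _ _ _ _ U h) (co W s i))); first last.
  + rewrite (res_comp _ _ (subset_trans (@zcapl _ _ T U) h)).
    rewrite -(res_comp (@zcapl _ _ W U) (@zcapS _ _ _ _ U h)) coP res_lincomb.
    by apply: eq_bigr => i _; rewrite (res_comp _ _ (@zcapr _ _ T U)).
  + by split.
  by apply/rowP => i; rewrite !mxE oval_res //; split.
exists U, e; split=> // i.
rewrite (evE _ _ U (@subset_refl _ U) (@subset_refl _ U) (fun l => (i == l)%:R)) //.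
  by apply/rowP => l; rewrite !mxE oval_delta // eqxx eq_sym.
rewrite (bigD1 i) //= eqxx scale1r big1 ?addr0 ?res_id // => l.
by rewrite eq_sym => /negPf->; rewrite scale0r.
Qed.

(** The rows of the matrix are the values at v of the images of a frame; linearity over the
    structure sheaf handles all other sections near v. *)
Lemma fibre_map F G v p q (evF : forall U, F U -> 'rV[k]_p)
    (evG : forall U, G U -> 'rV[k]_q) (f : omor F G) :
  fibre v evF -> fibre v evG ->
  exists A : 'M[k]_(p, q), forall U s, zset U v -> evG U (f U s) = evF U s *m A.
Proof.
move=> fF fG; have [U [e [Uv fe he]]] := fibre_frame fF.
exists (\matrix_i evG U (f U (e i))) => W s Wv.
have WUv : zset (zcap W U) v by split.
rewrite -(fibre_res fG (@zcapl _ _ W U)) // -omor_nat.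
rewrite -(fibre_res fF (@zcapl _ _ W U)) //.
have [a [-> _]] := fe _ (@zcapr _ _ W U) (res (@zcapl _ _ W U) s).
rewrite (fibre_lincomb fF) // => [|i]; last by rewrite (fibre_res fF).
rewrite omor_lincomb (fibre_sum fG) // mulmx_sum_row; apply: eq_bigr => i _.
by rewrite (fibreZ fG) // omor_nat (fibre_res fG) // rowK mxE.
Qed.

(** A vector of the target fibre extends to a section, which near v is the image of a section of
    F. *)
Lemma osurj_row_full F G v p q (evF : forall U, F U -> 'rV[k]_p)
    (evG : forall U, G U -> 'rV[k]_q) (f : omor F G) (A : 'M[k]_(p, q)) :
  fibre v evF -> fibre v evG -> osurj f ->
  (forall U s, zset U v -> evG U (f U s) = evF U s *m A) -> row_full A.
Proof.
move=> fF fG sf hA; rewrite -sub1mx; apply/row_subP => i.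
have [U [s [Uv <-]]] := fibre_lift fG (row i 1%:M).
have [W [h [t [Wv fts]]]] := sf U s v Uv.
by rewrite -(fibre_res fG h) // -fts hA // submxMl.
Qed.

End Sheaves.

(** * Local splitting of acyclic complexes and exactness on fibres *)

Section Exactness.
Variables (k : closedFieldType) (n : nat).
Implicit Types (U W T : zopen k n) (v : 'rV[k]_n.+1) (F G H K : omod k n).

Lemma zopen_fin_cap U v (I : finType) (W : I -> zopen k n) :
  zset U v -> (forall i, zset (W i) v) ->
  exists T : zopen k n, [/\ zset T v, T `<=` U & forall i, T `<=` W i].
Proof.
move=> Uv Wv; have [T [Tv TU TW]] : exists T : zopen k n,
    [/\ zset T v, T `<=` U & forall i, i \in enum I -> T `<=` W i].
  elim: (enum I) => [|i s [T [Tv TU TW]]]; first by exists U; split.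
  exists (zcap T (W i)); split; first by split.
    by move=> w [/TU].
  move=> l; rewrite inE => /predU1P[->|/TW Tl]; first exact: zcapr.
  by move=> w [/Tl].
by exists T; split=> // i; apply: TW; rewrite mem_enum.
Qed.

Lemma oexact_comp0 F G H (f : omor F G) (g : omor G H) : oexact f g ->
  forall U s, g U (f U s) = 0.
Proof.
move=> fg U s; apply/(fg U) => v Uv.
by exists U, (@subset_refl _ U), s; rewrite !res_id.
Qed.

(** Near [v] the kernel of [g] is lifted through [f] linearly with respect to
    the frame [e]: this is half of a local contracting homotopy, and unlike
    mere exactness it passes to the fibres. *)
Definition split_lift F G H (f : omor F G) (g : omor G H) v r U
    (e : 'I_r -> G U) : Prop :=
  exists W (h : W `<=` U) (y : 'I_r -> F W), zset W v /\
    forall T (hT : T `<=` W) (a : 'I_r -> oring T),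
      g T (\sum_i a i *: res (subset_trans hT h) (e i)) = 0 ->
      f T (\sum_i a i *: res hT (y i)) =
        \sum_i a i *: res (subset_trans hT h) (e i).

(** Write g e_i = sum_l c_il e'_l. Then s_i = e_i - sum_l c_il y'_l is killed by g, hence lifts
    through f near v. On a combination of the e_i lying in ker g the corrections cancel, so lifting
    each s_i lifts the combination linearly. *)
Lemma split_lift_step F G H K (f : omor F G) (g : omor G H) (g' : omor H K) v q :
  oexact f g -> (forall U s, g' U (g U s) = 0) -> vbundle H q ->
  (forall U (e : 'I_q -> H U), zset U v -> frame e -> split_lift g g' v e) ->
  forall r U (e : 'I_r -> G U), zset U v -> frame e -> split_lift f g v e.
Proof.
move=> fg g'g bH IH r U e Uv fe.
have [U' [e' [U'v fe']]] := bH v (zset_neq0 Uv).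
have [W' [hW' [y' [W'v hy']]]] := IH U' e' U'v fe'.
pose W := zcap U W'; have WU := @zcapl _ _ U W'; have WW' := @zcapr _ _ U W'.
have Wv : zset W v by split.
have hc i : {c : 'I_q -> oring W | g W (res WU (e i)) =
    \sum_l c l *: res (subset_trans WW' hW') (e' l)}.
  have [c [-> _]] := cid (fe' W (subset_trans WW' hW') (g W (res WU (e i)))).
  by exists c.
pose c i := sval (hc i).
have cP i : g W (res WU (e i)) = \sum_l c i l *: res (subset_trans WW' hW') (e' l).
  exact: svalP (hc i).
pose s i := res WU (e i) - \sum_l c i l *: res WW' (y' l).
have s0 i : g W (s i) = 0.
  by rewrite linearB /= hy' -cP ?subrr // g'g.
have Wi i : {W1 : zopen k n & {h : W1 `<=` W & {t : F W1 |
    zset W1 v /\ f W1 t = res h (s i)}}}.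
  have /cid[W1 /cid[h /cid[t ht]]] := (fg W (s i)).1 (s0 i) v Wv.
  by exists W1, h, t.
pose t1 i := sval (projT2 (projT2 (Wi i))).
have t1P i : zset (projT1 (Wi i)) v /\ f _ (t1 i) = res (projT1 (projT2 (Wi i))) (s i).
  exact: svalP (projT2 (projT2 (Wi i))).
have [T [Tv TW TWi]] := zopen_fin_cap Wv (fun i => (t1P i).1).
exists T, (subset_trans TW WU), (fun i => res (TWi i) (t1 i)); split=> // T' hT' a ga.
have T'W := subset_trans hT' TW; have T'W' := subset_trans T'W WW'.
have E i : res (subset_trans hT' (subset_trans TW WU)) (e i) = res T'W (res WU (e i)).
  by rewrite (res_comp _ _ (subset_trans hT' (subset_trans TW WU))).
pose b l : oring T' := \sum_i a i * (ores T'W (c i l) : oring T').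
(* These are the coordinates, in the frame [e'], of the image under g of the given combination. *)
have b0 l : b l = 0.
  apply: (frame_free (h := subset_trans T'W' hW') fe'); rewrite -{}[RHS]ga omor_lincomb.
  under eq_bigr do rewrite scaler_suml.
  rewrite exchange_big; apply: eq_bigr => i _; rewrite E omor_nat cP res_lincomb.
  rewrite scaler_sumr; apply: eq_bigr => m _.
  by rewrite scalerA (res_comp _ _ (subset_trans T'W' hW')).
rewrite omor_lincomb; transitivity (\sum_i a i *: res T'W (s i)).
  apply: eq_bigr => i _; congr (_ *: _).
  by rewrite !omor_nat (t1P i).2 (res_comp _ _ TW) (res_comp _ _ T'W).
have S0 : \sum_l b l *: res T'W' (y' l) = 0.
  by apply: big1 => l _; rewrite b0 scale0r.
rewrite -[RHS]subr0 -[X in _ = _ - X]S0.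
under [X in _ = _ - X]eq_bigr do rewrite scaler_suml.
rewrite exchange_big -sumrB; apply: eq_bigr => i _.
rewrite E /s resD resN scalerDr scalerN res_lincomb scaler_sumr; congr (_ - _).
by apply: eq_bigr => l _; rewrite scalerA (res_comp _ _ T'W').
Qed.

(** Descending induction on the degree, starting where the complex vanishes; m bounds the distance
    of u from N. *)
Lemma complex_split_lift (P : complex k n) (p : int -> nat) (N : int) :
  (forall t, vbundle (P t) (p t)) -> acyclic P ->
  (forall t : int, N <= t -> ozero (P t)) ->
  forall (t u w : int) (h : u = t + 1) (h' : w = u + 1) v r U (e : 'I_r -> P u U),
    zset U v -> frame e -> split_lift (diff P h) (diff P h') v e.
Proof.
move=> bP aP P0 t u w h h' v r U e Uv fe.
have [m hm] : exists m : nat, N <= u + m%:Z.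
  exists `|N - u|%N; rewrite -lerBlDl.
  exact: lez_abs.
elim: m t u w h h' r U e Uv fe hm => [|m IH] t u w h h' r U e Uv fe hm.
  rewrite addr0 in hm; exists U, (@subset_refl _ U), (fun=> 0); split=> // T hT a _.
  by rewrite (P0 _ hm _ (diff P h T _)) [RHS](P0 _ hm).
apply: (@split_lift_step _ _ _ _ (diff P h) (diff P h') (diff P (erefl (w + 1))) v (p w)) => //.
  by move=> V s; exact: diff_diff.
move=> V e' Vv fe'; apply: IH => //.
by rewrite h' -addrA -intS.
Qed.

(** Extend x to a section s0. The coordinates b_l of g s0 vanish at v, so subtracting sum_l b_l y_l,
    with y the local lifts, kills the image under g without changing the value at v. *)
Lemma fibre_kernel_lift G H K (g : omor G H) (g' : omor H K) v q r
    (evG : forall U, G U -> 'rV[k]_q) (evH : forall U, H U -> 'rV[k]_r)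
    (D : 'M[k]_(q, r)) :
  fibre v evG -> fibre v evH ->
  (forall U s, zset U v -> evH U (g U s) = evG U s *m D) ->
  (forall U s, g' U (g U s) = 0) ->
  (forall U (e : 'I_r -> H U), zset U v -> frame e -> split_lift g g' v e) ->
  forall x : 'rV[k]_q, x *m D = 0 ->
  exists U (s : G U), [/\ zset U v, g U s = 0 & evG U s = x].
Proof.
move=> fG fH gD g'g spl x xD.
have [U0 [s0 [U0v sx]]] := fibre_lift fG x.
have [U1 [e [U1v fe he]]] := fibre_frame fH.
have [W1 [hW1 [y [W1v hy]]]] := spl U1 e U1v fe.
pose W := zcap U0 W1; have WU := @zcapl _ _ U0 W1; have WW1 := @zcapr _ _ U0 W1.
have Wv : zset W v by split.
have [b [Eb _]] := fe W (subset_trans WW1 hW1) (g W (res WU s0)).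
have bv l : oval (b l) v = 0.
  have : evH W (g W (res WU s0)) = 0 by rewrite gD // (fibre_res fG) // sx.
  rewrite Eb (fibre_lincomb fH) => // [/rowP/(_ l)|i]; first by rewrite !mxE.
  by rewrite (fibre_res fH).
exists W, (res WU s0 - \sum_l b l *: res WW1 (y l)); split=> //.
  by rewrite linearB /= hy -Eb ?subrr ?g'g.
rewrite (fibreB fG) // (fibre_res fG) // sx (fibre_sum fG) // big1 ?subr0 // => l _.
by rewrite (fibreZ fG) // bv scale0r.
Qed.

(** A vector in the kernel on the fibre is the value of a section in the kernel of g by
    [fibre_kernel_lift]; sheaf exactness then applies to that section. *)
Lemma fibre_exact F G H K (f : omor F G) (g : omor G H) (g' : omor H K) v p q r
    (evF : forall U, F U -> 'rV[k]_p) (evG : forall U, G U -> 'rV[k]_q)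
    (evH : forall U, H U -> 'rV[k]_r) (C : 'M[k]_(p, q)) (D : 'M[k]_(q, r)) :
  fibre v evF -> fibre v evG -> fibre v evH ->
  (forall U s, zset U v -> evG U (f U s) = evF U s *m C) ->
  (forall U s, zset U v -> evH U (g U s) = evG U s *m D) ->
  oexact f g -> (forall U s, g' U (g U s) = 0) ->
  (forall U (e : 'I_r -> H U), zset U v -> frame e -> split_lift g g' v e) ->
  (kermx D :=: C)%MS.
Proof.
move=> fF fG fH fC gD fg g'g spl; apply/eqmxP/andP; split.
  apply/row_subP => i; have xD : row i (kermx D) *m D = 0.
    by apply/sub_kermxP; exact: row_sub.
  have [U [s [Uv gs <-]]] := fibre_kernel_lift fG fH gD g'g spl xD.
  have [W [h [t [Wv fts]]]] := (fg U s).1 gs v Uv.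
  by rewrite -(fibre_res fG h) // -fts fC // submxMl.
apply/sub_kermxP/row_matrixP => i; rewrite row0 row_mul.
have [U [s [Uv si]]] := fibre_lift fF (row i 1%:M).
rewrite -[C]mul1mx row_mul -si -fC // -gD // (oexact_comp0 fg).
by rewrite (fibre0 fH).
Qed.

End Exactness.

(** * Twists on charts; preservation of bundles and exactness *)

Section TwistLemmas.
Variables (k : closedFieldType) (n : nat).
Implicit Types (U W T : zopen k n) (v : 'rV[k]_n.+1) (F G H : omod k n) (d : int).

Lemma oval_ratio a b d W (ha : W `<=` zchart k a) (hb : W `<=` zchart k b) v :
  zset W v -> oval (Defs.ratio d ha hb) v = (v ord0 b / v ord0 a) ^ d.
Proof. by move=> Wv; rewrite (ovalE _ Wv). Qed.

Lemma ratio_trans a b c d W (ha : W `<=` zchart k a) (hb : W `<=` zchart k b)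
    (hc : W `<=` zchart k c) :
  Defs.ratio d ha hb * Defs.ratio d hb hc = Defs.ratio d ha hc :> oring W.
Proof.
apply: oval_ext => v Wv; rewrite ovalM !oval_ratio //.
have va := chart_neq0 (ha _ Wv); have vb := chart_neq0 (hb _ Wv).
by rewrite -expfzMl mulrC -mulrA mulKf.
Qed.

Lemma ratio_id a d W (ha : W `<=` zchart k a) : Defs.ratio d ha ha = 1 :> oring W.
Proof.
apply: oval_ext => v Wv; rewrite oval_ratio // oval1 //.
by rewrite divff ?exp1rz // (chart_neq0 (ha _ Wv)).
Qed.

Lemma ores_ratio a b d W T (h : T `<=` W) (ha : W `<=` zchart k a)
    (hb : W `<=` zchart k b) (ha' : T `<=` zchart k a) (hb' : T `<=` zchart k b) :
  ores h (Defs.ratio d ha hb) = Defs.ratio d ha' hb'.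
Proof.
by apply: oval_ext => v Tv; rewrite oval_res // !oval_ratio //; exact: h.
Qed.

(** Over open subsets of the chart x_a <> 0, where x_a^d is a frame of O(d), the
    twist F(d) is identified with F. *)
Definition tchart F d a W (h : W `<=` zchart k a) (s : twist F d W) : F W :=
  res (zcap_sub (@subset_refl _ W) h) (s a).

Lemma tchart_linear F d a W (h : W `<=` zchart k a) : linear (@tchart F d a W h).
Proof.
move=> c s t; rewrite /tchart resD resZ; congr (_ *: _ + _).
by rewrite (ores_comp _ _ (@subset_refl _ W)) ores_id.
Qed.

Lemma tchart_res F d a W T (h : W `<=` zchart k a) (hT : T `<=` W)
    (h' : T `<=` zchart k a) (s : twist F d W) :
  tchart h' (res hT s) = res hT (tchart h s).
Proof.
rewrite /tchart /= (res_comp _ _ (zcap_sub hT h')).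
by rewrite (res_comp _ _ (zcap_sub hT h')).
Qed.

Lemma tchart_twistm F G d a W (h : W `<=` zchart k a) (f : omor F G)
    (s : twist F d W) :
  tchart h (twistm d f W s) = f W (tchart h s).
Proof. by rewrite /tchart omor_nat. Qed.

(** Over a subset of the chart a, the compatibility relation recovers every component from the one
    at a. *)
Lemma tchart_inj F d a W (h : W `<=` zchart k a) : injective (@tchart F d a W h).
Proof.
move=> s t st; apply: tsec_eq => b.
have hb := @zcapr _ _ W (zchart k b); have hW := @zcapl _ _ W (zchart k b).
have ha : zcap W (zchart k b) `<=` zchart k a := subset_trans hW h.
have E (x : twist F d W) : x b = Defs.ratio d hb ha *: res hW (tchart h x).
  rewrite -[LHS](res_id (zcap_sub hW hb)) (tsecP x hW hb ha); congr (_ *: _).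
  by rewrite (res_comp _ _ (zcap_sub hW ha)).
by rewrite !E st.
Qed.

(** The component at b is (x_a / x_b)^d t; compatibility is the cocycle identity [ratio_trans]. *)
Lemma tchart_surj F d a W (h : W `<=` zchart k a) (t : F W) :
  exists s : twist F d W, tchart h s = t.
Proof.
pose hl b := @zcapl _ _ W (zchart k b); pose hr b := @zcapr _ _ W (zchart k b).
pose s b : F (zcap W (zchart k b)) :=
  Defs.ratio d (hr b) (subset_trans (hl b) h) *: res (hl b) t.
have sP b c T (hT : T `<=` W) (hb : T `<=` zchart k b) (hc : T `<=` zchart k c) :
    res (zcap_sub hT hb) (s b) = Defs.ratio d hb hc *: res (zcap_sub hT hc) (s c).
  rewrite !resZ !(res_comp _ _ hT) scalerA; congr (_ *: _).
  rewrite (@ores_ratio _ _ _ _ _ _ _ _ hb (subset_trans hT h)).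
  rewrite (@ores_ratio _ _ _ _ _ _ _ _ hc (subset_trans hT h)).
  by rewrite ratio_trans.
exists (TwistSec sP); rewrite /tchart /= /s resZ (res_comp _ _ (@subset_refl _ W)).
by rewrite (@ores_ratio _ _ _ _ _ _ _ _ h h) ratio_id scale1r res_id.
Qed.

Lemma vbundle_twist F d r : vbundle F r -> vbundle (twist F d) r.
Proof.
move=> bF v v0; have [U [e [Uv fe]]] := bF v v0; have [a va] := exists_chart v0.
pose W := zcap U (zchart k a); have WU := @zcapl _ _ U (zchart k a).
have Wa := @zcapr _ _ U (zchart k a).
pose e' i := sval (cid (@tchart_surj F d a W Wa (res WU (e i)))).
have he' i : tchart Wa (e' i) = res WU (e i) by rewrite /e'; case: cid.
exists W, e'; split=> [|T hT s]; first by split.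
have Ta := subset_trans hT Wa.
have E (c : {ffun 'I_r -> oring T}) :
    tchart Ta (\sum_i c i *: res hT (e' i)) = \sum_i c i *: res (subset_trans hT WU) (e i).
  pose L : {linear twist F d T -> F T} :=
    HB.pack (tchart Ta) (GRing.isLinear.Build _ _ _ _ _ (@tchart_linear F d a T Ta)).
  have -> : tchart Ta (\sum_i c i *: res hT (e' i)) = L (\sum_i c i *: res hT (e' i)) by [].
  rewrite linear_sum; apply: eq_bigr => i _; rewrite linearZ /=; congr (_ *: _).
  by rewrite (tchart_res Wa) he' (res_comp _ _ (subset_trans hT WU)).
have [c [hc uc]] := fe T (subset_trans hT WU) (tchart Ta s).
exists c; split=> [|c' hc']; first by apply: (@tchart_inj _ _ _ _ Ta); rewrite E.
by apply: uc; rewrite hc' E.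
Qed.

Lemma oexact_twist F G H d (f : omor F G) (g : omor G H) :
  oexact f g -> oexact (twistm d f) (twistm d g).
Proof.
move=> fg U s; split=> [gs v Uv|im].
  have [a va] := exists_chart (zset_neq0 Uv).
  pose W := zcap U (zchart k a).
  have gsa : g W (s a) = 0 by have := congr1 (fun x : twist H d U => x a) gs.
  have [T [hT [t [Tv ft]]]] := (fg W (s a)).1 gsa v (conj Uv va).
  have Ta : T `<=` zchart k a := subset_trans hT (@zcapr _ _ _ _).
  have [t' ht'] := tchart_surj d Ta t.
  exists T, (subset_trans hT (@zcapl _ _ _ _)), t'; split=> //.
  apply: (@tchart_inj _ _ _ _ Ta); rewrite tchart_twistm ht' ft /tchart /=.
  by rewrite (res_comp _ _ hT).
apply: section_eq_local => v /im[W [h [t [Wv ft]]]]; exists W, h; split=> //.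
rewrite -omor_nat -ft res0; apply: tsec_eq => a /=.
exact: (oexact_comp0 fg).
Qed.

Lemma ozero_twist F d : ozero F -> ozero (twist F d).
Proof. by move=> F0 U s; apply: tsec_eq => a; rewrite [LHS]F0 [RHS]F0. Qed.

Lemma acyclic_shift_twist (Q : complex k n) d j :
  acyclic Q -> acyclic (cshift (ctwist Q d) j).
Proof. by move=> aQ t u w h h'; apply: oexact_twist; exact: aQ. Qed.

End TwistLemmas.

(** * Direct sums of line bundles O(e), their twists and fibres *)

Section LinearBundles.
Variables (k : closedFieldType) (n : nat).
Implicit Types (U W T : zopen k n) (v : 'rV[k]_n.+1) (F G : omod k n) (d e : int).

(** The value is taken at the vector v rather than at its line, so no trivialisation of O(e) has to
    be chosen. *)
Definition orow e q U (s : osum q (ostruct k n e) U) v : 'rV[k]_q :=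
  \row_l oval ((s : {ffun 'I_q -> osec e U}) l) v.

Lemma orow_linear e q U (a : oring U) (s t : osum q (ostruct k n e) U) v :
  orow (a *: s + t) v = oval a v *: orow s v + orow t v.
Proof. by apply/rowP => l; rewrite !mxE !ffunE ovalD ovalZ. Qed.

Lemma orowZ e q U (a : oring U) (s : osum q (ostruct k n e) U) v :
  orow (a *: s) v = oval a v *: orow s v.
Proof. by apply/rowP => l; rewrite !mxE ffunE ovalZ. Qed.

Lemma orow_res e q U W (h : W `<=` U) (s : osum q (ostruct k n e) U) v :
  zset W v -> orow (res h s) v = orow s v.
Proof. by move=> Wv; apply/rowP => l; rewrite !mxE ffunE oval_res. Qed.

Lemma orow_ext e q U (s t : osum q (ostruct k n e) U) :
  (forall v, zset U v -> orow s v = orow t v) -> s = t.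
Proof.
move=> st; apply/ffunP => l; apply: oval_ext => v Uv.
by have /rowP/(_ l) := st v Uv; rewrite !mxE.
Qed.

Lemma osum_exists e q U (f : 'rV[k]_n.+1 -> 'rV[k]_q) :
  (forall v, zset U v -> exists (W : zopen k n) (s : osum q (ostruct k n e) W),
     [/\ zset W v, W `<=` U & forall w, zset W w -> orow s w = f w]) ->
  exists s : osum q (ostruct k n e) U, forall v, zset U v -> orow s v = f v.
Proof.
move=> hf; have hs l : exists s : osec e U, forall v, zset U v -> oval s v = f v 0 l.
  apply: osec_glue => v /hf[W [s [Wv WU sf]]].
  exists W, ((s : {ffun 'I_q -> osec e W}) l); split=> // w /sf <-.
  by rewrite mxE.
exists [ffun l => sval (cid (hs l))] => v Uv; apply/rowP => l.
by rewrite mxE ffunE; case: cid => s /= ->.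
Qed.

(** Multiplication by x_a^d, a section of O(d) over the chart for either sign of d. *)
Lemma osum_scale_coord e d e' q a U (s : osum q (ostruct k n e) U) :
  e' = e + d -> U `<=` zchart k a ->
  exists t : osum q (ostruct k n e') U,
    forall v, zset U v -> orow t v = v ord0 a ^ d *: orow s v.
Proof.
move=> -> Ua; have hs l : exists t : osec (e + d) U, forall v, zset U v ->
    oval t v = oval ((s : {ffun 'I_q -> osec e U}) l) v * v ord0 a ^ d.
  apply: osec_exists; apply: regularM; first exact: oval_regular.
  exact: coord_pow_regular.
exists [ffun l => sval (cid (hs l))] => v Uv; apply/rowP => l.
by rewrite !mxE ffunE; case: cid => t /= ->; rewrite // mulrC.
Qed.

Lemma osum_chart_exists e q a (x : 'rV[k]_q) :
  exists t : osum q (ostruct k n e) (zchart k a),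
    forall v, zset (zchart k a) v -> orow t v = v ord0 a ^ e *: x.
Proof.
pose c l := sval (cid (oconst_exists (zchart k a) (x 0 l))).
have [|t ht] := @osum_scale_coord 0 e e q a (zchart k a)
  [ffun l => c l] _ (@subset_refl _ _); first by rewrite add0r.
exists t => v Uv; rewrite ht //; congr (_ *: _); apply/rowP => l.
by rewrite mxE ffunE /c; case: cid => u /= ->.
Qed.

Lemma osum_mulmx e p q U (A : 'M[k]_(p, q)) (s : osum p (ostruct k n e) U) :
  exists t : osum q (ostruct k n e) U,
    forall v, zset U v -> orow t v = orow s v *m A.
Proof.
pose c i l := sval (cid (oconst_exists U (A i l))).
exists [ffun l => \sum_i c i l *: (s : {ffun 'I_p -> osec e U}) i] => v Uv.
apply/rowP => l; rewrite !mxE ffunE oval_sum; apply: eq_bigr => i _.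
by rewrite ovalZ mxE mulrC /c; case: cid => u /= ->.
Qed.

Section TwistIso.
Variables (F : omod k n) (e d e' : int) (q : nat).
Variable g : omor F (osum q (ostruct k n e)).
Hypotheses (gbij : forall U, bijective (g U)) (Ee : e' = e + d).

(** The compatibility relation says precisely that x_a^d s_a does not depend on the chart. *)
Lemma twist_orow_chart U (s : twist F d U) a b v : zset U v ->
    v ord0 a != 0 -> v ord0 b != 0 ->
  v ord0 a ^ d *: orow (g _ (s a)) v = v ord0 b ^ d *: orow (g _ (s b)) v.
Proof.
move=> Uv va vb; pose W := zcap U (zcap (zchart k a) (zchart k b)).
have hU : W `<=` U by move=> w [].
have ha : W `<=` zchart k a by move=> w [_ []].
have hb : W `<=` zchart k b by move=> w [_ []].
have Wv : zset W v by split=> //; split; apply: chartP.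
have := congr1 (fun x => orow (g W x) v) (tsecP s hU ha hb).
rewrite /= linearZ orowZ !omor_nat !orow_res // oval_ratio // => ->.
by rewrite scalerA -expfzMl mulrC divfK.
Qed.

(** The coordinate picked is immaterial by [twist_orow_chart]; the default 0 is reached only at the
    origin, which lies in no open set. *)
Let tval U (s : twist F d U) v : 'rV[k]_q :=
  if [pick a | v ord0 a != 0] is Some a then v ord0 a ^ d *: orow (g _ (s a)) v
  else 0.

Lemma twist_valE U (s : twist F d U) a v : zset U v -> v ord0 a != 0 ->
  tval s v = v ord0 a ^ d *: orow (g _ (s a)) v.
Proof.
move=> Uv va; rewrite /tval; case: pickP => [b vb|/(_ a)]; last by rewrite va.
exact: twist_orow_chart.
Qed.

(** The isomorphism sends (s_a) to the common value of the x_a^d g(s_a), and its inverse sends t to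
    the family of the g^(-1)(x_a^(-d) t). *)
Lemma oiso_twist_osum : oiso (twist F d) (osum q (ostruct k n e')).
Proof.
have hs U (s : twist F d U) :
    {t : osum q (ostruct k n e') U | forall v, zset U v -> orow t v = tval s v}.
  apply: cid; apply: osum_exists => v Uv.
  have [a va] := exists_chart (zset_neq0 Uv).
  have [t ht] := osum_scale_coord (g _ (s a)) Ee (@zcapr _ _ U (zchart k a)).
  exists (zcap U (zchart k a)), t; split=> [||w Ww]; [by split|exact: zcapl|].
  by rewrite ht // (@twist_valE _ _ a) //; [case: Ww|apply: chart_neq0; case: Ww].
have [L LP] : exists L : forall U, twist F d U -> osum q (ostruct k n e') U,
    forall U (s : twist F d U) a v, zset U v -> v ord0 a != 0 ->
      orow (L U s) v = v ord0 a ^ d *: orow (g _ (s a)) v.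
  exists (fun U s => sval (hs U s)) => U s a v Uv va.
  by rewrite (svalP (hs U s)) // (twist_valE _ Uv va).
have [||f hf] := @omor_exists _ _ (twist F d) (osum q (ostruct k n e')) L.
- move=> U c s t; apply: orow_ext => v Uv.
  have [a /chart_neq0 va] := exists_chart (zset_neq0 Uv).
  have UaV : zset (zcap U (zchart k a)) v by split=> //; exact: chartP.
  rewrite orow_linear !(LP _ _ a) //= linearP orow_linear oval_res //.
  by rewrite scalerDr scalerA mulrC -scalerA.
- move=> U W h s; apply: orow_ext => v Wv.
  have [a /chart_neq0 va] := exists_chart (zset_neq0 Wv).
  have WaV : zset (zcap W (zchart k a)) v by split=> //; exact: chartP.
  by rewrite orow_res // !(LP _ _ a) //=; [rewrite omor_nat orow_res|exact: h].
exists f => U.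
have f_inj : injective (f U).
  move=> s t; rewrite !hf => st; apply: tsec_eq => a.
  apply: (bij_inj (gbij _)); apply: orow_ext => v [Uv /chart_neq0 va].
  have := congr1 (fun x => orow x v) st; rewrite !(LP _ _ a) //.
  by apply: scalerI; exact: expfz_neq0.
have [g' hg'] := omor_inv gbij.
have f_surj (t : osum q (ostruct k n e') U) : {s | f U s = t}.
  apply: cid; have Ee' : e = e' + - d by rewrite Ee addrK.
  have ht a : {u : osum q (ostruct k n e) (zcap U (zchart k a)) |
      forall v, zset (zcap U (zchart k a)) v -> orow u v = v ord0 a ^ (- d) *: orow t v}.
    apply: cid; have [u hu] := osum_scale_coord (res (@zcapl _ _ U (zchart k a)) t)
      Ee' (@zcapr _ _ U (zchart k a)).
    by exists u => v Uv; rewrite hu // orow_res.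
  have sP a b W (h : W `<=` U) (ha : W `<=` zchart k a) (hb : W `<=` zchart k b) :
      res (zcap_sub h ha) (g' _ (sval (ht a))) =
        Defs.ratio d ha hb *: res (zcap_sub h hb) (g' _ (sval (ht b))).
    apply: (bij_inj (gbij _)); apply: orow_ext => v Wv.
    have [/chart_neq0 va /chart_neq0 vb] := (ha v Wv, hb v Wv).
    rewrite linearZ orowZ !omor_nat !orow_res // !(hg' _).2 oval_ratio //.
    rewrite !(svalP (ht _)); try by split; [exact: h|exact: chartP].
    rewrite scalerA -!exprz_inv -expfzMl; congr (_ ^ _ *: _).
    by rewrite mulrAC divff ?mul1r.
  exists (TwistSec sP); apply: orow_ext => v Uv.
  have [a /chart_neq0 va] := exists_chart (zset_neq0 Uv).
  rewrite hf (LP _ _ a) //= (hg' _).2 (svalP (ht a)); last by split=> //; exact: chartP.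
  by rewrite scalerA -expfzDr // subrr scale1r.
exists (fun t => sval (f_surj t)) => [s|t]; last exact: svalP (f_surj t).
by apply: f_inj; rewrite (svalP (f_surj _)).
Qed.

End TwistIso.

Lemma fibre_osum F q e (g : omor F (osum q (ostruct k n e))) v :
  (forall U, bijective (g U)) -> v != 0 -> fibre v (fun U s => orow (g U s) v).
Proof.
move=> gbij v0; have [g' hg'] := omor_inv gbij.
split=> [U Uv a s t|U W h s Wv|]; first by rewrite linearP orow_linear.
  by rewrite omor_nat orow_res.
have [a va] := exists_chart v0; have va0 := chart_neq0 va.
pose U := zchart k a.
(* The frame is (x_a / v_a)^e times the standard basis, normalised so that its value at v is the
   standard basis. *)
have hd i := cid (osum_chart_exists e a (v ord0 a ^ (- e) *: delta_mx 0 i : 'rV[k]_q)).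
exists U, (fun i => g' U (sval (hd i))); split=> // [T hT s|i]; last first.
  by rewrite (hg' U).2 (svalP (hd i)) // scalerA -expfzDr // subrr scale1r.
have E (c : {ffun 'I_q -> oring T}) w : zset T w ->
    orow (g T (\sum_i c i *: res hT (g' U (sval (hd i))))) w =
    (w ord0 a ^ e * v ord0 a ^ (- e)) *: \row_i oval (c i) w.
  move=> Tw; rewrite omor_lincomb (big_morph (fun t => orow t w)
    (fun s t => _ : orow (s + t) w = orow s w + orow t w) (_ : orow 0 w = 0)).
  - rewrite [X in _ = _ *: X]row_sum_delta scaler_sumr; apply: eq_bigr => i _.
    rewrite orowZ omor_nat orow_res // (hg' U).2 (svalP (hd i)); last exact: hT.
    by rewrite mxE !scalerA [RHS in _ = RHS *: _]mulrC mulrA.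
  - by move=> x y; have := orow_linear 1 x y w; rewrite !scale1r oval1 // scale1r.
  - by apply/rowP => l; rewrite !mxE ffunE oval0.
have nz w : zset T w -> w ord0 a ^ e * v ord0 a ^ (- e) != 0.
  by move=> /hT/chart_neq0 wa; rewrite mulf_neq0 ?expfz_neq0.
(* The coordinates of s in this frame are x_a^(-e) v_a^e times those of g s. *)
have [t ht] := @osum_scale_coord e (- e) 0 q a T (g T s) (esym (subrr e)) hT.
have [b hb] := oconst_exists T (v ord0 a ^ e).
pose c : {ffun 'I_q -> oring T} :=
  [ffun l => b * ((t : {ffun 'I_q -> oring T}) l)].
have cP w : zset T w -> \row_i oval (c i) w =
    (w ord0 a ^ e * v ord0 a ^ (- e))^-1 *: orow (g T s) w.
  move=> Tw; apply: (scalerI (expfz_neq0 (- e) va0)).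
  transitivity (orow t w).
    apply/rowP => l; rewrite !mxE ffunE ovalM hb // mulrA -expfzDr //.
    by rewrite addNr mul1r.
  by rewrite ht // scalerA invfM mulrCA divff ?expfz_neq0 // mulr1 invr_expz.
exists c; split=> [|c' hc'].
  apply: (bij_inj (gbij T)); apply: orow_ext => w Tw.
  by rewrite E // cP // scalerA divff ?nz // scale1r.
apply/ffunP => l; apply: oval_ext => w Tw.
have : \row_i oval (c i) w = \row_i oval (c' i) w.
  by rewrite cP // hc' E // scalerA mulVf ?nz // scale1r.
by move/rowP/(_ l); rewrite !mxE.
Qed.

End LinearBundles.

(** * Matrices of morphisms, rank computations and alternating sums *)

Section Matrices.
Variables (k : closedFieldType) (n : nat).
Implicit Types (U W T : zopen k n) (v : 'rV[k]_n.+1) (F G : omod k n) (d e : int).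

Lemma mulmx_row_inj m q (A B : 'M[k]_(m, q)) :
  (forall x : 'rV[k]_m, x *m A = x *m B) -> A = B.
Proof.
by move=> AB; apply/row_matrixP => i; rewrite !rowE AB.
Qed.

(** The matrices on the fibres have rows that glue to global sections of O(d)^q, because each row is
    given by a section on every chart. *)
Lemma omor_osum_matrix F G p q e d e' (f : omor F G)
    (gF : omor F (osum p (ostruct k n e))) (gG : omor G (osum q (ostruct k n e'))) :
  (forall U, bijective (gF U)) -> (forall U, bijective (gG U)) -> e' = e + d ->
  exists A : 'I_p -> 'I_q -> osec d (ztop k n), forall U s v, zset U v ->
    orow (gG U (f U s)) v = orow (gF U s) v *m \matrix_(i, l) oval (A i l) v.
Proof.
move=> bF bG Ee.
have fm v : exists A : 'M[k]_(p, q), forall U s, zset U v ->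
    orow (gG U (f U s)) v = orow (gF U s) v *m A.
  (* At the origin any matrix will do, since no open set contains it. *)
  have [v0|/negP v0] := boolP (v != 0); last by exists 0 => U s /zset_neq0.
  exact: (fibre_map f (fibre_osum bF v0) (fibre_osum bG v0)).
pose m v := sval (cid (fm v)).
have mP v U s : zset U v -> orow (gG U (f U s)) v = orow (gF U s) v *m m v.
  exact: (svalP (cid (fm v))).
have hA i : exists t : osum q (ostruct k n d) (ztop k n),
    forall v, zset (ztop k n) v -> orow t v = row i (m v).
  apply: osum_exists => v v0; have [a va] := exists_chart v0.
  (* On the chart a, row i is x_a^(-e) times the image of x_a^e times the i-th basis vector. *)
  have [x hx] := osum_chart_exists e a (delta_mx 0 i : 'rV[k]_p).
  have [gF' hF'] := omor_inv bF.
  have [|t ht] := @osum_scale_coord k n e' (- e) d q a _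
    (gG _ (f _ (gF' _ x))) _ (@subset_refl _ (zchart k a)).
    by rewrite Ee addrC addKr.
  exists (zchart k a), t; split=> [//|w /zset_neq0 //|w Uw].
  rewrite ht // mP // (hF' _).2 hx // -scalemxAl scalerA -expfzDr ?(chart_neq0 Uw) //.
  by rewrite addNr scale1r -rowE.
exists (fun i l => (sval (cid (hA i)) : {ffun 'I_q -> osec d (ztop k n)}) l).
move=> U s v Uv; rewrite mP //; congr (_ *m _); apply/matrixP => i l; rewrite mxE.
have /rowP/(_ l) := svalP (cid (hA i)) v (zset_neq0 Uv).
by rewrite !mxE => ->.
Qed.

(** rank (N D1) is dim ker A1 minus dim (ker A1 meet im D0). The latter is rank D0 - rank (D0 A1) =
    rank D0 - rank D0', as D0 A1 = A0 D0' with A0 surjective. Exactness turns the ranks of D0 and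
    D0' into those of D1 and D1'. *)
Lemma rank_kernel_image p0 p1 p2 q0 q1 q2 c (A0 : 'M[k]_(p0, q0))
    (A1 : 'M[k]_(p1, q1)) (D0 : 'M[k]_(p0, p1)) (D1 : 'M[k]_(p1, p2))
    (D0' : 'M[k]_(q0, q1)) (D1' : 'M[k]_(q1, q2)) (N : 'M[k]_(c, p1)) :
  D0 *m A1 = A0 *m D0' -> row_full A0 -> row_full A1 ->
  (kermx D1 :=: D0)%MS -> (kermx D1' :=: D0')%MS -> (N :=: kermx A1)%MS ->
  (\rank (N *m D1) + \rank D1' = \rank D1)%N.
Proof.
move=> DA fA0 fA1 ex ex' EN.
have rA1 : \rank A1 = q1 by apply/eqP.
have := mxrank_mul_ker N D1; have := mxrank_mul_ker D0 A1.
have := mxrank_ker D1; have := mxrank_ker D1'; have := mxrank_ker A1.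
have := rank_leq_row D1; have := rank_leq_row D1'; have := rank_leq_row A1.
rewrite rA1 DA (eqmxMfull _ fA0) ex ex' EN.
have -> : \rank (N :&: kermx D1) = \rank (D0 :&: kermx A1).
  by rewrite capmxC (cap_eqmx ex EN).
move: (\rank (N *m D1)) (\rank (D0 :&: _)) (\rank (kermx A1)) (\rank D0) (\rank D0')
  (\rank D1) (\rank D1') => a b c1 r0 r0' r1 r1'.
lia.
Qed.

Lemma exists_kernel_basis p q (A : 'M[k]_(p, q)) : row_full A ->
  exists N : 'M[k]_(p - q, p), row_free N /\ (N :=: kermx A)%MS.
Proof.
move=> /eqP fA; have E : \rank (kermx A) = (p - q)%N by rewrite mxrank_ker fA.
by rewrite -E; exists (row_base (kermx A)); split; [exact: row_base_free|exact: eq_row_base].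
Qed.

Lemma altsum_pos (p : int -> nat) m : 0 < m -> altsum p m = 0.
Proof. by move=> m0; rewrite /altsum leNgt m0 /= big_ord0. Qed.

Lemma altsum_rec (p : int -> nat) m : m <= 0 ->
  altsum p m = (p m)%:Z - altsum p (m + 1).
Proof.
move=> m0; rewrite /altsum m0 big_ord_recl /= expr0 mul1r addr0; congr (_ + _).
rewrite -sumrN.
have -> : (if m + 1 <= 0 then `|(m + 1)%R|%N.+1 else 0%N) = `|m|%N.
  by case: ifP => m1; lia.
apply: eq_bigr => i _; rewrite /bump /= exprS mulN1r mulNr.
by rewrite add1n intS addrA.
Qed.

End Matrices.

(** * Ranks of differentials and lifts compatible with a morphism *)

Section ConstantRank.
Variables (k : closedFieldType) (n : nat).
Implicit Types (U W T : zopen k n) (v : 'rV[k]_n.+1) (F G : omod k n).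

(** Exactness on fibres gives rank D = p u - rank D' for the next differential D', which is the
    recursion [altsum_rec]. Since [altsum] stops at index 0, the ranks are reindexed by the top
    degree N. *)
Lemma complex_fibre_rank (P : complex k n) (p : int -> nat) (N : int) v :
  (forall t, vbundle (P t) (p t)) -> acyclic P ->
  (forall t : int, N < t -> ozero (P t)) -> v != 0 ->
  forall (t u : int) (h : u = t + 1) (evt : forall U, P t U -> 'rV[k]_(p t))
    (evu : forall U, P u U -> 'rV[k]_(p u)) (D : 'M[k]_(p t, p u)),
    fibre v evt -> fibre v evu ->
    (forall U s, zset U v -> evu U (diff P h U s) = evt U s *m D) ->
    (\rank D)%:Z = altsum (fun t => p (t + N)) (u - N).
Proof.
move=> bP aP P0 v0.
suff main (m : nat) (t u : int) (h : u = t + 1)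
    (evt : forall U, P t U -> 'rV[k]_(p t)) (evu : forall U, P u U -> 'rV[k]_(p u))
    (D : 'M[k]_(p t, p u)) : fibre v evt -> fibre v evu ->
    (forall U s, zset U v -> evu U (diff P h U s) = evt U s *m D) ->
    N < u + m%:Z -> (\rank D)%:Z = altsum (fun t => p (t + N)) (u - N).
  move=> t u h evt evu D ft fu hD; apply: (main `|N - u|%N.+1 t u h evt evu) => //.
  by lia.
elim: m t u h evt evu D => [|m IH] t u h evt evu D ft fu hD.
  rewrite addr0 => Nu; rewrite altsum_pos ?subr_gt0 //.
  have -> : D = 0; last by rewrite mxrank0.
  apply: mulmx_row_inj => x; rewrite mulmx0.
  have [U [s [Uv <-]]] := fibre_lift ft x.
  by rewrite -hD // (P0 _ Nu _ (diff P h U s)) (fibre0 fu).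
move=> Nu; have [uN|Nu'] := leP u N; last first.
  by apply: (IH t u h evt evu D ft fu hD); lia.
pose w := u + 1; have h' : w = u + 1 by [].
have [evw fw] := vbundle_fibre (bP w) v0.
have [D' hD'] := fibre_map (diff P h') fu fw.
have ker : (kermx D' :=: D)%MS.
  apply: (fibre_exact ft fu fw hD hD' (aP t u w h h')
    (g' := diff P (erefl (w + 1)))) => [U s|]; first exact: diff_diff.
  (* The shift to N + 1 occurs because here vanishing holds strictly above N. *)
  move=> U e Uv fe; apply: (complex_split_lift (N := N + 1) bP aP) => // t' ht'.
  by apply: P0; lia.
rewrite -ker mxrank_ker altsum_rec ?subr_le0 // subrK addrAC.
rewrite -(IH u w h' evu evw D' fu fw hD'); first by have := rank_leq_row D'; lia.
by rewrite /w -addrA -intS.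
Qed.

Section CompatibleLift.
Variables (F0 F1 F2 F3 G0 G1 G2 : omod k n).
Variables (d0 : omor F0 F1) (d1 : omor F1 F2) (d2 : omor F2 F3).
Variables (d0' : omor G0 G1) (d1' : omor G1 G2).
Variables (f0 : omor F0 G0) (f1 : omor F1 G1) (f2 : omor F2 G2).

(* A local section of ker d1 with the prescribed value [x] is corrected by a
   coboundary vanishing at [v]: its image under f1 is, by [split_lift], the
   coboundary of a section vanishing at [v], which lifts through f0. *)
Lemma fibre_kernel_lift_compat v p1 p2 q1
    (ev1 : forall U, F1 U -> 'rV[k]_p1) (ev2 : forall U, F2 U -> 'rV[k]_p2)
    (ev1' : forall U, G1 U -> 'rV[k]_q1)
    (A1 : 'M[k]_(p1, q1)) (D1 : 'M[k]_(p1, p2)) :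
  fibre v ev1 -> fibre v ev2 -> fibre v ev1' ->
  (forall U s, zset U v -> ev1' U (f1 U s) = ev1 U s *m A1) ->
  (forall U s, zset U v -> ev2 U (d1 U s) = ev1 U s *m D1) ->
  (forall U s, f1 U (d0 U s) = d0' U (f0 U s)) ->
  (forall U s, f2 U (d1 U s) = d1' U (f1 U s)) ->
  (forall U s, d1 U (d0 U s) = 0) -> (forall U s, d2 U (d1 U s) = 0) ->
  osurj f0 ->
  (forall U (e : 'I_p2 -> F2 U), zset U v -> frame e -> split_lift d1 d2 v e) ->
  (forall U (e : 'I_q1 -> G1 U), zset U v -> frame e -> split_lift d0' d1' v e) ->
  forall x : 'rV[k]_p1, x *m D1 = 0 -> x *m A1 = 0 ->
  exists U (s : F1 U), [/\ zset U v, d1 U s = 0, f1 U s = 0 & ev1 U s = x].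
Proof.
move=> f_1 f_2 f_1' hA hD fd0 fd1 dd0 dd1 sf0 spl spl' x xD xA.
have [U [s [Uv ds sx]]] := fibre_kernel_lift f_1 f_2 hD dd1 spl xD.
have [V [e [Vv fe he]]] := fibre_frame f_1'.
have [W [hW [y [Wv hy]]]] := spl' V e Vv fe.
have Yi l : {T : zopen k n & {h : T `<=` W & {t : F0 T |
    zset T v /\ f0 T t = res h (y l)}}}.
  have /cid[T /cid[h /cid[t ht]]] := sf0 W (y l) v Wv.
  by exists T, h, t.
pose t1 l := sval (projT2 (projT2 (Yi l))).
have t1P l : zset (projT1 (Yi l)) v /\ f0 _ (t1 l) = res (projT1 (projT2 (Yi l))) (y l).
  exact: svalP (projT2 (projT2 (Yi l))).
have UWv : zset (zcap U W) v by split.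
have [T [Tv TUW TY]] := zopen_fin_cap UWv (fun l => (t1P l).1).
have TU := subset_trans TUW (@zcapl _ _ U W); have TW := subset_trans TUW (@zcapr _ _ U W).
have [b [Eb _]] := fe T (subset_trans TW hW) (f1 T (res TU s)).
have bv l : oval (b l) v = 0.
  have : ev1' T (f1 T (res TU s)) = 0 by rewrite hA // (fibre_res f_1) // sx.
  rewrite Eb (fibre_lincomb f_1') // => [/rowP/(_ l)|i]; first by rewrite !mxE.
  by rewrite (fibre_res f_1').
have dT : d1 T (res TU s) = 0 by rewrite omor_nat ds res0.
exists T, (res TU s - \sum_l b l *: d0 T (res (TY l) (t1 l))); split=> //.
- rewrite linearB /= dT omor_lincomb big1 ?subr0 // => l _.
  by rewrite dd0 scaler0.
- rewrite linearB /= omor_lincomb.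
  have -> : \sum_l b l *: f1 T (d0 T (res (TY l) (t1 l))) =
      d0' T (\sum_l b l *: res TW (y l)).
    rewrite omor_lincomb; apply: eq_bigr => l _; congr (_ *: _).
    by rewrite fd0 omor_nat (t1P l).2 (res_comp _ _ TW).
  by rewrite hy -Eb ?subrr // -fd1 dT linear0.
rewrite (fibreB f_1) // (fibre_res f_1) // sx (fibre_sum f_1) // big1 ?subr0 //.
by move=> l _; rewrite (fibreZ f_1) // bv scale0r.
Qed.

End CompatibleLift.

End ConstantRank.

(** * Construction of the linear matrix and its constant rank *)

Section LinearMatrix.
Variables (k : closedFieldType) (n : nat).
Implicit Types (U W T : zopen k n) (v : 'rV[k]_n.+1) (F G : omod k n).

Lemma ztop_osec0_matrix p q (A : 'I_p -> 'I_q -> osec 0 (ztop k n)) :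
  exists B : 'M[k]_(p, q), forall v, v != 0 -> \matrix_(i, l) oval (A i l) v = B.
Proof.
have c i l := cid (ztop_osec0_const (A i l)).
exists (\matrix_(i, l) sval (c i l)) => v v0.
by apply/matrixP => i l; rewrite !mxE (svalP (c i l)).
Qed.

(** The transpose reconciles morphisms acting on row vectors with a matrix whose rows are indexed by
    the target. *)
Lemma ztop_osec1_matrix p q (A : 'I_p -> 'I_q -> osec 1 (ztop k n)) :
  exists M : 'M[{mpoly k[n.+1]}]_(q, p), linear_matrix M /\
    forall v, v != 0 -> \matrix_(i, l) oval (A i l) v = (map_mx (meval (v ord0)) M)^T.
Proof.
have c i l := cid (ztop_osec1_linear (A i l)).
exists (\matrix_(l, i) sval (c i l)); split=> [l i|v v0].
  by rewrite mxE; have [] := svalP (c i l).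
by apply/matrixP => i l; rewrite !mxE (svalP (c i l)).2.
Qed.

(** Serves as the trivialisation of a sheaf that is already a sum of copies of O(e). *)
Lemma omor_id F : exists f : omor F F, forall U s, f U s = s.
Proof. exact: omor_exists. Qed.

Lemma omor_mulmx e p q (N : 'M[k]_(p, q)) :
  exists f : omor (osum p (ostruct k n e)) (osum q (ostruct k n e)),
    forall U s v, zset U v -> orow (f U s) v = orow s v *m N.
Proof.
have mN U (s : osum p (ostruct k n e) U) := cid (osum_mulmx N s).
have [||f hf] := @omor_exists _ _ (osum p (ostruct k n e))
    (osum q (ostruct k n e)) (fun U s => sval (mN U s)).
- move=> U a s t; apply: orow_ext => v Uv.
  rewrite orow_linear !(svalP (mN _ _)) // orow_linear mulmxDl.
  by rewrite -scalemxAl.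
- move=> U W h s; apply: orow_ext => v Wv.
  by rewrite orow_res // !(svalP (mN _ _)) ?orow_res //; exact: h.
by exists f => U s v Uv; rewrite hf (svalP (mN U s)).
Qed.

Lemma orow0 e q U v : orow (0 : osum q (ostruct k n e) U) v = 0.
Proof. by apply/rowP => l; rewrite !mxE !ffunE oval0. Qed.

(** Here [Q] is the target of the morphism, already twisted and shifted, so that one index i and one
    twist e serve both complexes. [NP] and [NQ] are upper bounds for their degrees. *)
Lemma constant_rank_linear_matrix (P Q : complex k n) (p q : int -> nat)
    (phi : cmor P Q) (i e NP NQ : int) (b : nat) :
  (forall t, vbundle (P t) (p t)) -> (forall t, vbundle (Q t) (q t)) ->
  acyclic P -> acyclic Q ->
  (forall t : int, NP < t -> ozero (P t)) -> (forall t : int, NQ < t -> ozero (Q t)) ->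
  oiso (P (i + 1)) (osum (p (i + 1)) (ostruct k n e)) ->
  oiso (Q (i + 1)) (osum (q (i + 1)) (ostruct k n e)) ->
  osurj (phi i) -> osurj (phi (i + 1)) ->
  dim_ker (phi (i + 1 + 1)) (e + 1) b ->
  exists M : 'M[{mpoly k[n.+1]}]_(b, p (i + 1) - q (i + 1)),
    linear_matrix M /\
    constant_rank M (altsum (fun t => p (t + NP)) (i + 1 + 1 - NP)
                     - altsum (fun t => q (t + NQ)) (i + 1 + 1 - NQ)).
Proof.
move=> bP bQ aP aQ P0 Q0 [gP bgP] [gQ bgQ] sphi0 sphi1 [iota ker].
pose dP t : omor (P t) (P (t + 1)) := diff P (erefl (t + 1)).
pose dQ t : omor (Q t) (Q (t + 1)) := diff Q (erefl (t + 1)).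
have [gP' hgP'] := omor_inv bgP.
have [Av hAv] := omor_osum_matrix (phi (i + 1)) bgP bgQ (esym (addr0 e)).
have [A AE] := ztop_osec0_matrix Av.
have hA U s v : zset U v ->
    orow (gQ U (phi (i + 1) U s)) v = orow (gP U s) v *m A.
  by move=> Uv; rewrite hAv // AE // (zset_neq0 Uv).
have fA : row_full A.
  (* As [A] does not depend on the point, its rank may be read at any single one. *)
  have v0 : (const_mx 1 : 'rV[k]_n.+1) != 0.
    by apply/eqP => /rowP/(_ 0)/eqP; rewrite !mxE oner_eq0.
  by apply: (osurj_row_full (fibre_osum bgP v0) (fibre_osum bgQ v0) sphi1) => U s /hA.
have [N [freeN EN]] := exists_kernel_basis fA.
set c := subn _ _ in N freeN EN *.
pose E := osum c (ostruct k n e).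
have [nuN hnuN] := omor_mulmx e N; have [nu hnu'] := omor_comp nuN gP'.
have hnu U s v : zset U v -> orow (gP U (nu U s)) v = orow s v *m N.
  by move=> Uv; rewrite hnu' (hgP' U).2 hnuN.
have NA : N *m A = 0 by apply/sub_kermxP; rewrite EN.
have phinu U s : phi (i + 1) U (nu U s) = 0.
  apply: (bij_inj (bgQ U)); apply: orow_ext => v Uv; rewrite hA // hnu // linear0.
  by rewrite orow0 -mulmxA NA mulmx0.
have [dnu hdnu] := omor_comp nu (dP (i + 1)).
have phi_d t U s : phi (t + 1) U (dP t U s) = dQ t U (phi t U s) by exact: cmor_diff.
have phidnu U s : phi (i + 1 + 1) U (dnu U s) = 0.
  by rewrite hdnu phi_d phinu linear0.
(* The restriction of d to the kernel of phi_(i+1) factors through ker phi_(i+2). Source and target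
   of [mu] are sums of O(e) and O(e+1), so its entries are sections of O(1). *)
have [mu hmu] := omor_kernel_lift ker phidnu.
have [idE hidE] := omor_id E; have [idB hidB] := omor_id (osum b (ostruct k n (e + 1))).
have idE_bij U : bijective (idE U) by exists id => s; rewrite hidE.
have idB_bij U : bijective (idB U) by exists id => s; rewrite hidB.
have [L hL] := omor_osum_matrix mu idE_bij idB_bij (erefl (e + 1)).
have [M [linM ML]] := ztop_osec1_matrix L.
exists M; split=> // v v0; rewrite -mxrank_tr -ML //.
set Lv := \matrix_(_, _) _.
have hLv U s : zset U v -> orow (mu U s) v = orow s v *m Lv.
  by move=> Uv; have := hL U s v Uv; rewrite hidB hidE.
have f1 := fibre_osum bgP v0; have f1' := fibre_osum bgQ v0.
have fE := fibre_osum idE_bij v0; have fB := fibre_osum idB_bij v0.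
have [ev0 f0] := vbundle_fibre (bP i) v0.
have [ev0' f0'] := vbundle_fibre (bQ i) v0.
have [ev2 f2] := vbundle_fibre (bP (i + 1 + 1)) v0.
have [ev2' f2'] := vbundle_fibre (bQ (i + 1 + 1)) v0.
have [D0 hD0] := fibre_map (dP i) f0 f1; have [D1 hD1] := fibre_map (dP (i + 1)) f1 f2.
have [D0' hD0'] := fibre_map (dQ i) f0' f1'.
have [D1' hD1'] := fibre_map (dQ (i + 1)) f1' f2'.
have [A0 hA0] := fibre_map (phi i) f0 f0'.
have fA0 := osurj_row_full f0 f0' sphi0 hA0.
have [I hI] := fibre_map iota fB f2.
have splP t r U (s : 'I_r -> P (t + 1) U) : zset U v -> frame s ->
    split_lift (dP t) (dP (t + 1)) v s.
  apply: (complex_split_lift (N := NP + 1) bP aP) => // t' ht'.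
  by apply: P0; lia.
have splQ t r U (s : 'I_r -> Q (t + 1) U) : zset U v -> frame s ->
    split_lift (dQ t) (dQ (t + 1)) v s.
  apply: (complex_split_lift (N := NQ + 1) bQ aQ) => // t' ht'.
  by apply: Q0; lia.
have ddP t U s : dP (t + 1) U (dP t U s) = 0 by exact: diff_diff.
have ddQ t U s : dQ (t + 1) U (dQ t U s) = 0 by exact: diff_diff.
have exP := fibre_exact f0 f1 f2 hD0 hD1 (aP _ _ _ _ _) (ddP _) (splP (i + 1) _).
have exQ := fibre_exact f0' f1' f2' hD0' hD1' (aQ _ _ _ _ _) (ddQ _) (splQ (i + 1) _).
have DA : D0 *m A = A0 *m D0'.
  apply: mulmx_row_inj => x; have [U [s [Uv <-]]] := fibre_lift f0 x.
  by rewrite !mulmxA -hD0 // -hA // phi_d hD0' // hA0.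
have rk := rank_kernel_image DA fA0 fA exP exQ EN.
rewrite -(complex_fibre_rank bP aP P0 v0 f1 f2 hD1).
rewrite -(complex_fibre_rank bQ aQ Q0 v0 f1' f2' hD1') -rk PoszD addrK.
(* The fibre of [iota] composed with [mu] is d restricted to ker A; this gives rank Lv >= rank (N
   D1). *)
have LI : Lv *m I = N *m D1.
  apply: mulmx_row_inj => x; have [U [s [Uv]]] := fibre_lift fE x.
  rewrite hidE => <-; rewrite !mulmxA -hLv //.
  by have := hI U (mu U s) Uv; rewrite hidB hmu hdnu hD1 // hnu // => <-.
(* The reverse bound uses that [iota] is injective on sections: x is realised as the value of a
   section a whose image under [nu] is killed by d, whence mu a = 0. *)
have kerL : (kermx (N *m D1) <= kermx Lv)%MS.
  apply/row_subP => l; set x := row l _.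
  have xD : x *m N *m D1 = 0 by rewrite -mulmxA; apply/sub_kermxP; exact: row_sub.
  have xA : x *m N *m A = 0 by rewrite -mulmxA NA mulmx0.
  have [U [s [Uv ds phis sx]]] := fibre_kernel_lift_compat f1 f2 f1' (fun U s => @hA U s v)
    hD1 (phi_d i) (phi_d (i + 1)) (ddP i) (ddP (i + 1)) sphi0 (splP (i + 1) _)
    (splQ i _) xD xA.
  (* The values of s are killed by [A], so they lie in the row space of [N] and the pseudo-inverse
     recovers their coordinates. *)
  have [a ha] := osum_mulmx (pinvmx N) (gP U s).
  have nua : nu U a = s.
    apply: (bij_inj (bgP U)); apply: orow_ext => w Uw.
    rewrite hnu // ha // mulmxKpV // EN; apply/sub_kermxP.
    by rewrite -hA // phis linear0 orow0.
  have mua : mu U a = 0.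
    by apply: (ker U).1; rewrite hmu hdnu nua ds linear0.
  apply/sub_kermxP; have <- : orow a v = x.
    by apply: (row_free_inj freeN); rewrite -hnu // nua sx.
  by rewrite -hLv // mua orow0.
congr Posz; apply/eqP; rewrite eqn_leq -{2}LI mxrankM_maxl andbT.
have := mxrankS kerL; rewrite !mxrank_ker.
by have := rank_leq_row Lv; have := rank_leq_row (N *m D1); lia.
Qed.

End LinearMatrix.

Theorem theorem3p1 (k : closedFieldType) (n : nat) (P Q : complex k n)
    (p q : int -> nat) (j : int) (phi : cmor P (cshift (ctwist Q (- j)) j))
    (rP sP rQ sQ : int) (i : int) (b : nat) :
  [pchar k] =i pred0 ->
  (forall t : int, vbundle (P t) (p t)) ->
  (forall t : int, vbundle (Q t) (q t)) ->
  acyclic P -> acyclic Q ->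
  (forall t : int, ~~ (- n.+1%:Z <= t <= 0) -> ozero (P t)) ->
  (forall t : int, ~~ (- n.+1%:Z <= t <= 0) -> ozero (Q t)) ->
  clinear P p rP sP ->
  clinear Q q rQ sQ ->
  rP <= i < sP ->
  rQ <= i + j < sQ ->
  osurj (phi i) ->
  osurj (phi (i + 1)) ->
  dim_ker (phi (i + 2)) (i + 2) b ->
  exists M : 'M[{mpoly k[n.+1]}]_(b, p (i + 1) - q (i + j + 1)),
    linear_matrix M /\
    constant_rank M (altsum p (i + 2) - altsum q (i + j + 2)).
Proof.
move=> _ bP bQ aP aQ P0 Q0 linP linQ hP hQ sphi0 sphi1.
have -> : i + 2 = i + 1 + 1 by rewrite -addrA.
have -> : i + j + 2 = i + 1 + 1 + j by lia.
rewrite (addrAC i j 1) => ker.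
have [gQ bgQ] : oiso (Q (i + 1 + j)) (osum (q (i + 1 + j)) (ostruct k n (i + 1 + j))).
  by apply: linQ; lia.
have isoP : oiso (P (i + 1)) (osum (p (i + 1)) (ostruct k n (i + 1))).
  by apply: linP; lia.
(* Twisting by -j brings the term O(i+1+j)^q of Q back to O(i+1)^q, the same twist as on the side of
   P. *)
have isoQ := oiso_twist_osum bgQ (_ : i + 1 = i + 1 + j + - j).
(* The degree bounds are 0 for P and -j for Q(-j)[j], since the shift moves degree 0 of Q to index
   -j. *)
have [||||M [linM rkM]] := @constant_rank_linear_matrix k n P (cshift (ctwist Q (- j)) j)
  p (fun t => q (t + j)) phi i (i + 1) 0 (- j) b bP _ aP
  (@acyclic_shift_twist _ _ Q (- j) j aQ) _ _ isoP _ sphi0 sphi1 ker.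
- by move=> t; apply: vbundle_twist; exact: bQ.
- by move=> t t0; apply: P0; lia.
- by move=> t t0; apply: ozero_twist; apply: Q0; lia.
- by apply: isoQ; rewrite addrK.
exists M; split=> // v v0; rewrite (rkM v v0) subr0 opprK.
congr (altsum _ _ - altsum _ _); apply: funext => t; first by rewrite addr0.
by rewrite addrNK.
Qed.
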